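(* Let $n\in\mathbb{N}\cup\{\infty\}$, $n\geq2$, and let $\underline{\Gamma}$ be an $n$-monotone exact functional on a linear lattice $\mathcal{K}$ of gambles on a non-empty set $\Omega$ that contains all constant gambles. Then $\underline{\Gamma}$ has a unique exact extension to $\operatorname{cl}(\mathcal{K})$, and this extension is $n$-monotone as well. Denote by $\underline{\Psi}$ the restriction of $\underline{\Gamma}$ to $\mathcal{F}_{\mathcal{K}}$. Then for all $f\in\mathcal{L}_{\mathcal{F}_{\mathcal{K}}}$, $$\underline{E}_{\underline{\Gamma}}(f)=\underline{E}_{\underline{\Psi}}(f)=(C)\int f\,\mathrm{d}\underline{\Psi}_*=\|\underline{\Gamma}\|\inf f+(R)\int_{\inf f}^{\sup f}\underline{\Psi}_*(\{f\geq x\})\,\mathrm{d}x.$$ Consequently, $\underline{E}_{\underline{\Gamma}}$ is both $n$-monotone and comonotone additive on $\mathcal{L}_{\mathcal{F}_{\mathcal{K}}}$.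
   Context: $\mathbb{N}=\{1,2,\dots\}$. A gamble on $\Omega$ is a bounded real-valued map on $\Omega$; $\mathcal{L}$ is the set of all gambles, with pointwise operations and order; a real number $\mu$ also denotes the constant gamble $\mu$. An event $A\subseteq\Omega$ is identified with its indicator gamble $I_A$. A functional is a real-valued map defined on a subset of $\mathcal{L}$ (its domain, $\operatorname{dom}$); a set function is a functional whose domain consists of (indicators of) events. A functional on $\mathcal{L}$ is exact if for all $f,g\in\mathcal{L}$, real $\lambda\geq0$ and real $\mu$: (E1) $f\geq g$ implies $\underline{\Gamma}(f)\geq\underline{\Gamma}(g)$; (E2) $\underline{\Gamma}(\lambda f)=\lambda\underline{\Gamma}(f)$; (E3) $\underline{\Gamma}(f+g)\geq\underline{\Gamma}(f)+\underline{\Gamma}(g)$; (E4) $\underline{\Gamma}(f+\mu)=\underline{\Gamma}(f)+\underline{\Gamma}(\mu)$. A functional on an arbitrary subset of $\mathcal{L}$ is exact if it can be extended to an exact functional on $\mathcal{L}$. Norm: $\|\underline{\Gamma}\|$ is the infimum of all $c\geq0$ such that for all $m\in\mathbb{N}$, $\lambda_1,\dots,\lambda_m\geq0$, $\lambda\in\mathbb{R}$ and $f,f_1,\dots,f_m\in\operatorname{dom}\underline{\Gamma}$: $f\geq\sum_{k=1}^m\lambda_kf_k+\lambda$ implies $\underline{\Gamma}(f)\geq\sum_{k=1}^m\lambda_k\underline{\Gamma}(f_k)+\lambda c$. (Known: finite if and only if $\underline{\Gamma}$ is exact, and equal to $\underline{\Gamma}(1)$ if $\underline\Gamma$ is exact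 and $1\in\operatorname{dom}\underline{\Gamma}$.) Natural extension of an exact functional $\underline{\Gamma}$: the functional on $\mathcal{L}$ given by $\underline{E}_{\underline{\Gamma}}(f)=\sup\{\sum_{k=1}^m\lambda_k\underline{\Gamma}(f_k)+\lambda\|\underline{\Gamma}\| : m\in\mathbb{N},\lambda_k\geq0,\lambda\in\mathbb{R},f_k\in\operatorname{dom}\underline{\Gamma},\sum_{k=1}^m\lambda_kf_k+\lambda\leq f\}$; $\underline{E}_{\underline{\Psi}}$ is defined in the same way from $\underline{\Psi}$. (Known: it is an exact extension with the same norm.) A linear lattice is a linear subspace of $\mathcal{L}$ closed under pointwise minimum $\wedge$ and maximum $\vee$. A functional on a lattice of gambles is $n$-monotone if for all $p\in\mathbb{N}$, $p\leq n$, and all $f,f_1,\dots,f_p$ in its domain, $\sum_{I\subseteq\{1,\dots,p\}}(-1)^{|I|}\underline{\Gamma}(f\wedge\bigwedge_{i\in I}f_i)\geq0$ (for $I=\emptyset$ the term $\bigwedge_{i\in I}f_i$ is dropped). $\operatorname{cl}$ denotes closure in $\mathcal{L}$ with respect to the supremum norm (uniform closure). $\mathcal{F}_{\mathcal{K}}=\{A\subseteq\Omega: I_A\in\mathcal{K}\}$, which is a field of subsets of $\Omega$; $\underline{\Psi}(A)=\underline{\Gamma}(I_A)$ for $A\in\mathcal{F}_{\mathcal{K}}$. $\mathcal{L}_{\mathcal{F}_{\mathcal{K}}}=\operatorname{cl}(\operatorname{span}\{I_A:I_A\in\mathcal{K}\})$. Inner set function: $\underline{\Psi}_*(A)=\sup\{\underline{\Psi}(B):B\in\mathcal{F}_{\mathcal{K}},B\subseteq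 A\}$ for $A\subseteq\Omega$. Choquet integral: for a monotone real-valued set function $\mu$ on the power set of $\Omega$ with $\mu(\emptyset)=0$, $(C)\int f\,\mathrm{d}\mu=\mu(\Omega)\inf f+(R)\int_{\inf f}^{\sup f}\mu(\{f\geq x\})\,\mathrm{d}x$ for every gamble $f$, where $(R)\int$ is the Riemann integral and $\{f\geq x\}=\{\omega\in\Omega:f(\omega)\geq x\}$. Gambles $f,g$ are comonotone if for all $\omega_1,\omega_2\in\Omega$, $f(\omega_1)<f(\omega_2)$ implies $g(\omega_1)\leq g(\omega_2)$. A functional is comonotone additive on a set of gambles if it is additive on all comonotone pairs $f,g$ in that set. *)

(* Defs.v *)
From Stdlib Require Import Reals List ClassicalEpsilon.
From Coquelicot Require Import Coquelicot.
Open Scope R_scope.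

Set Implicit Arguments.
Unset Strict Implicit.

Definition gamble {Omega : Type} (f : Omega -> R) : Prop :=
  exists M, forall w, Rabs (f w) <= M.

Definition gle {Omega : Type} (f g : Omega -> R) : Prop := forall w, f w <= g w.
Definition gadd {Omega : Type} (f g : Omega -> R) : Omega -> R := fun w => f w + g w.
Definition gsub {Omega : Type} (f g : Omega -> R) : Omega -> R := fun w => f w - g w.
Definition gscal {Omega : Type} (a : R) (f : Omega -> R) : Omega -> R := fun w => a * f w.
Definition gmin {Omega : Type} (f g : Omega -> R) : Omega -> R := fun w => Rmin (f w) (g w).
Definition gmax {Omega : Type} (f g : Omega -> R) : Omega -> R := fun w => Rmax (f w) (g w).
Definition gconst {Omega : Type} (mu : R) : Omega -> R := fun _ => mu.
Definition lincomb {Omega : Type} (m : nat) (lam : nat -> R) (fs : nat -> Omega -> R)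
  : Omega -> R := fun w => sum_n_m (fun k => lam k * fs k w) 1 m.

Definition indicator {Omega : Type} (A : Omega -> Prop) : Omega -> R :=
  fun w => if excluded_middle_informative (A w) then 1 else 0.

(* Real-valued; meaningful for gambles on a non-empty set, where the bounds are finite. *)
Definition ginf {Omega : Type} (f : Omega -> R) : R :=
  real (Glb_Rbar (fun x => exists w, x = f w)).
Definition gsup {Omega : Type} (f : Omega -> R) : R :=
  real (Lub_Rbar (fun x => exists w, x = f w)).

(* A functional with domain D is encoded by the pair of D and a total map G whose
   values outside D are irrelevant; restricting it means shrinking D. *)

Record exact_on_all {Omega : Type} (G : (Omega -> R) -> R) : Prop := {
  exact_mono : forall f g, gamble f -> gamble g -> gle g f -> G g <= G f;
  exact_scal : forall f lam, gamble f -> 0 <= lam -> G (gscal lam f) = lam * G f;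
  exact_superadd : forall f g, gamble f -> gamble g -> G f + G g <= G (gadd f g);
  exact_const : forall f mu, gamble f -> G (gadd f (gconst mu)) = G f + G (gconst mu)
}.

Definition extends {Omega : Type} (D : (Omega -> R) -> Prop)
    (G H : (Omega -> R) -> R) : Prop :=
  forall f, D f -> H f = G f.

Definition exact {Omega : Type} (D : (Omega -> R) -> Prop) (G : (Omega -> R) -> R) : Prop :=
  exists H, exact_on_all H /\ extends D G H.

Definition norm_bound {Omega : Type} (D : (Omega -> R) -> Prop) (G : (Omega -> R) -> R)
    (c : R) : Prop :=
  0 <= c /\
  forall (m : nat) (lams : nat -> R) (lam : R) (f : Omega -> R) (fs : nat -> Omega -> R),
    (1 <= m)%nat ->
    (forall k, (1 <= k <= m)%nat -> 0 <= lams k /\ D (fs k)) ->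
    D f ->
    gle (gadd (lincomb m lams fs) (gconst lam)) f ->
    sum_n_m (fun k => lams k * G (fs k)) 1 m + lam * c <= G f.

(* Equal to [p_infty] when there is no admissible constant. *)
Definition fnorm {Omega : Type} (D : (Omega -> R) -> Prop) (G : (Omega -> R) -> R) : Rbar :=
  Glb_Rbar (norm_bound D G).

(* The supremum is taken in the extended reals.  It is used for exact functionals only,
   for which [fnorm] is finite. *)
Definition natural_extension {Omega : Type} (D : (Omega -> R) -> Prop)
    (G : (Omega -> R) -> R) (f : Omega -> R) : Rbar :=
  Lub_Rbar (fun x =>
    exists (m : nat) (lams : nat -> R) (lam : R) (fs : nat -> Omega -> R),
      (1 <= m)%nat /\
      (forall k, (1 <= k <= m)%nat -> 0 <= lams k /\ D (fs k)) /\
      gle (gadd (lincomb m lams fs) (gconst lam)) f /\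
      x = sum_n_m (fun k => lams k * G (fs k)) 1 m + lam * real (fnorm D G)).

Record lattice_of_gambles {Omega : Type} (K : (Omega -> R) -> Prop) : Prop := {
  lattice_gamble : forall f, K f -> gamble f;
  lattice_min : forall f g, K f -> K g -> K (gmin f g);
  lattice_max : forall f g, K f -> K g -> K (gmax f g)
}.

Record linear_lattice {Omega : Type} (K : (Omega -> R) -> Prop) : Prop := {
  linlat_lattice : lattice_of_gambles K;
  linlat_zero : K (gconst 0);
  linlat_add : forall f g, K f -> K g -> K (gadd f g);
  linlat_scal : forall a f, K f -> K (gscal a f)
}.

(* Elements of N together with infinity, the latter being [None]. *)
Definition le_infty (p : nat) (n : option nat) : Prop :=
  match n with Some k => (p <= k)%nat | None => True end.

(* All sublists of l; applied to a list without repetition, these enumerate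
   every subset of its elements exactly once. *)
Fixpoint subsets (l : list nat) : list (list nat) :=
  match l with
  | nil => nil :: nil
  | i :: l' => subsets l' ++ map (cons i) (subsets l')
  end.

Definition n_monotone {Omega : Type} (n : option nat) (D : (Omega -> R) -> Prop)
    (G : (Omega -> R) -> R) : Prop :=
  lattice_of_gambles D /\
  forall (p : nat) (f : Omega -> R) (fs : nat -> Omega -> R),
    (1 <= p)%nat -> le_infty p n ->
    D f -> (forall i, (1 <= i <= p)%nat -> D (fs i)) ->
    0 <= fold_right Rplus 0
           (map (fun I => (-1) ^ length I * G (fold_right (fun i g => gmin (fs i) g) f I))
                (subsets (seq 1 p))).

Definition sup_norm {Omega : Type} (f : Omega -> R) : Rbar :=
  Lub_Rbar (fun x => exists w, x = Rabs (f w)).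

Definition uniform_closure {Omega : Type} (S : (Omega -> R) -> Prop) (f : Omega -> R) : Prop :=
  gamble f /\
  forall eps, 0 < eps -> exists g, S g /\ Rbar_lt (sup_norm (gsub f g)) eps.

Definition span {Omega : Type} (S : (Omega -> R) -> Prop) (f : Omega -> R) : Prop :=
  exists (m : nat) (lams : nat -> R) (fs : nat -> Omega -> R),
    (forall k, (1 <= k <= m)%nat -> S (fs k)) /\ f = lincomb m lams fs.

Definition events_in {Omega : Type} (K : (Omega -> R) -> Prop) (A : Omega -> Prop) : Prop :=
  K (indicator A).

Definition indicators_of {Omega : Type} (F : (Omega -> Prop) -> Prop) (f : Omega -> R) : Prop :=
  exists A, F A /\ f = indicator A.

Definition gambles_of_events {Omega : Type} (F : (Omega -> Prop) -> Prop)
  : (Omega -> R) -> Prop := uniform_closure (span (indicators_of F)).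

Definition inner_set_function {Omega : Type} (F : (Omega -> Prop) -> Prop)
    (psi : (Omega -> Prop) -> R) (A : Omega -> Prop) : R :=
  real (Lub_Rbar (fun x => exists B, F B /\ (forall w, B w -> A w) /\ x = psi B)).

Definition upper_level {Omega : Type} (f : Omega -> R) (x : R) : Omega -> Prop :=
  fun w => x <= f w.

(* [RInt] is the Riemann integral; it is meaningful under [ex_RInt]. *)
Definition choquet {Omega : Type} (mu : (Omega -> Prop) -> R) (f : Omega -> R) : R :=
  mu (fun _ => True) * ginf f
  + RInt (fun x => mu (upper_level f x)) (ginf f) (gsup f).

Definition comonotone {Omega : Type} (f g : Omega -> R) : Prop :=
  forall w1 w2, f w1 < f w2 -> g w1 <= g w2.

Definition comonotone_additive {Omega : Type} (D : (Omega -> R) -> Prop)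
    (G : (Omega -> R) -> R) : Prop :=
  forall f g, D f -> D g -> comonotone f g -> G (gadd f g) = G f + G g.

(* Main.v *)
(* Let H be an exact extension of Gamma to all gambles. Exactness makes H Lipschitz with constant
   H(1) for the supremum norm, so on cl(K) it is determined by Gamma, is n-monotone, and coincides
   with the natural extension.

   2-monotonicity makes H additive over level slices: for x <= y, H(f ^ y) - H(f ^ x) is the value
   of H at the part of f between x and y. A gamble belongs to L_F iff any two of its level sets
   {f >= t}, {f >= s} with s < t can be separated by an event of F; this squeezes the slice between
   multiples of indicators of F and gives, for x' < x < y and phi(x) = Psi_*({f >= x}),
     (y - x) phi(y) <= H(f ^ y) - H(f ^ x) <= (y - x) phi(x').
   Summing over a fine grid, the errors telescope because phi is monotone, and H(f) is the Choquet
   integral. For comonotone f and g, both are nondecreasing 1-Lipschitz functions of h = f + g, and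
   the same squeeze, with the level sets of h, applies to f, g and h simultaneously. *)
Require Import Defs.
From Stdlib Require Import Reals Lra Lia List ClassicalEpsilon FunctionalExtensionality.
From Coquelicot Require Import Coquelicot.
Open Scope R_scope.

(** * Sums and integrals *)

Ltac case_minmax :=
  unfold Rmin, Rmax; repeat destruct Rle_dec; lra.

Lemma sum_S (u : nat -> R) (m : nat) :
  sum_n_m u 1 (S m) = sum_n_m u 1 m + u (S m).
Proof. rewrite sum_n_Sm by lia. reflexivity. Qed.

Lemma sum_0 (u : nat -> R) : sum_n_m u 1 0 = 0.
Proof. rewrite sum_n_m_zero by lia. reflexivity. Qed.

Lemma sum_1 (u : nat -> R) : sum_n_m u 1 1 = u 1%nat.
Proof. apply sum_n_n. Qed.

Lemma sum_le (u v : nat -> R) (m : nat) :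
  (forall k, (1 <= k <= m)%nat -> u k <= v k) -> sum_n_m u 1 m <= sum_n_m v 1 m.
Proof.
  induction m as [|m IH]; intros Huv.
  - rewrite !sum_0. lra.
  - rewrite !sum_S. apply Rplus_le_compat.
    + apply IH. intros k Hk. apply Huv. lia.
    + apply Huv. lia.
Qed.

(** The errors met later are multiples of [eps] by a Lipschitz constant that may be zero, hence the
    division by [c + 1] in the proof. *)
Lemma le_of_le_plus_eps (x y c : R) :
  0 <= c -> (forall eps, 0 < eps -> x <= y + c * eps) -> x <= y.
Proof.
  intros Hc Hxy. apply Rle_plus_epsilon. intros eps Heps.
  apply Rle_trans with (y + c * (eps / (c + 1))).
  - apply Hxy. apply Rdiv_lt_0_compat; lra.
  - apply Rplus_le_compat_l.
    replace eps with ((c + 1) * (eps / (c + 1))) at 2 by (field; lra).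
    assert (0 < eps / (c + 1)) by (apply Rdiv_lt_0_compat; lra). nra.
Qed.

Lemma exists_small_step (L eps : R) :
  0 < eps -> exists N : nat, (0 < N)%nat /\ L < INR N * eps.
Proof.
  intros Heps. destruct (INR_unbounded (Rmax (L / eps) 0)) as [N HN].
  exists N. split.
  - apply INR_lt. simpl. apply Rle_lt_trans with (2 := HN). apply Rmax_r.
  - apply Rlt_div_l; [lra|]. apply Rle_lt_trans with (2 := HN). apply Rmax_l.
Qed.

Lemma Lub_Rbar_approx (E : R -> Prop) (l : R) :
  (forall x, E x -> x <= l) ->
  (forall eps, 0 < eps -> exists x, E x /\ l <= x + eps) ->
  Lub_Rbar E = Finite l.
Proof.
  intros Hub Happ. apply is_lub_Rbar_unique. split.
  - intros x Hx. exact (Hub x Hx).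
  - intros b Hb. destruct b as [b| |]; simpl.
    + apply Rle_plus_epsilon. intros eps Heps.
      destruct (Happ eps Heps) as [x [Ex Hx]]. generalize (Hb x Ex). simpl. lra.
    + exact I.
    + destruct (Happ 1 Rlt_0_1) as [x [Ex _]]. exact (Hb x Ex).
Qed.

Lemma Glb_Rbar_attained (E : R -> Prop) (l : R) :
  E l -> (forall x, E x -> l <= x) -> Glb_Rbar E = Finite l.
Proof.
  intros El Hlb. apply is_glb_Rbar_unique. split.
  - intros x Hx. exact (Hlb x Hx).
  - intros b Hb. exact (Hb l El).
Qed.

(** Non-emptiness and boundedness exclude the infinite cases, in which [real] would return a default
    value. *)
Lemma Lub_Rbar_bounded (E : R -> Prop) (M x0 : R) :
  E x0 -> (forall x, E x -> x <= M) ->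
  (forall x, E x -> x <= real (Lub_Rbar E)) /\
  (forall c, (forall x, E x -> x <= c) -> real (Lub_Rbar E) <= c).
Proof.
  intros E0 HM. destruct (Lub_Rbar_correct E) as [Hub Hleast].
  destruct (Lub_Rbar E) as [l| |] eqn:HE; simpl.
  - split; [exact Hub|]. intros c Hc. exact (Hleast (Finite c) Hc).
  - destruct (Hleast (Finite M) HM).
  - destruct (Hub x0 E0).
Qed.

(** The indicator is constant on either side of the supremum [c] of [P] on the interval; its value
    at [c] itself does not affect integrability. *)
Lemma ex_RInt_initial_interval (P : R -> Prop) (a b : R) :
  (forall x y, x <= y -> P y -> P x) -> a <= b -> ex_RInt (indicator P) a b.
Proof.
  intros HP Hab. destruct (excluded_middle_informative (P a)) as [Pa|nPa].
  - destruct (completeness (fun x => a <= x <= b /\ P x)) as [c [Hub Hleast]].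
    { exists b. intros x [Hx _]. lra. }
    { exists a. split; [lra|exact Pa]. }
    assert (a <= c) by (apply Hub; split; [lra|exact Pa]).
    assert (c <= b) by (apply Hleast; intros x [Hx _]; lra).
    apply ex_RInt_Chasles with c.
    + apply ex_RInt_ext with (fun _ => 1); [|apply ex_RInt_const].
      intros x. rewrite Rmin_left, Rmax_right by lra. intros Hx.
      unfold indicator. destruct excluded_middle_informative as [_|nPx]; [reflexivity|].
      exfalso. assert (c <= x); [|lra]. apply Hleast. intros y [Hy Py].
      destruct (Rle_lt_dec y x) as [Hyx|Hyx]; [exact Hyx|].
      destruct nPx. apply HP with y; [lra|exact Py].
    + apply ex_RInt_ext with (fun _ => 0); [|apply ex_RInt_const].
      intros x. rewrite Rmin_left, Rmax_right by lra. intros Hx.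
      unfold indicator. destruct excluded_middle_informative as [Px|_]; [|reflexivity].
      exfalso. assert (x <= c); [|lra]. apply Hub. split; [lra|exact Px].
  - apply ex_RInt_ext with (fun _ => 0); [|apply ex_RInt_const].
    intros x. rewrite Rmin_left, Rmax_right by lra. intros Hx.
    unfold indicator. destruct excluded_middle_informative as [Px|_]; [|reflexivity].
    destruct nPa. apply HP with x; [lra|exact Px].
Qed.

(** The [k]-th summand is the part of [v] between the levels [c + (k - 1) d] and [c + k d]; stacking
    the layers restores [v - c], truncated to [[0, N d]]. *)
Lemma sum_slices (v c d : R) (N : nat) :
  0 <= d ->
  sum_n_m (fun k => Rmin (Rmax (v - (c + (INR k - 1) * d)) 0) d) 1 N
  = Rmin (Rmax (v - c) 0) (INR N * d).
Proof.
  intros Hd. induction N as [|N IH].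
  - rewrite sum_0. simpl. case_minmax.
  - rewrite sum_S, IH, S_INR.
    assert (0 <= INR N * d) by (apply Rmult_le_pos; [apply pos_INR|exact Hd]).
    replace ((INR N + 1 - 1) * d) with (INR N * d) by ring.
    replace ((INR N + 1) * d) with (INR N * d + d) by ring.
    set (t := INR N * d) in *. clearbody t. case_minmax.
Qed.

Lemma indicator_cases {Omega : Type} (A : Omega -> Prop) (w : Omega) :
  (A w /\ indicator A w = 1) \/ (~ A w /\ indicator A w = 0).
Proof. unfold indicator. destruct excluded_middle_informative; auto. Qed.

Lemma ex_RInt_sum (u : nat -> R -> R) (a b : R) (m : nat) :
  (forall k, ex_RInt (u k) a b) -> ex_RInt (fun x => sum_n_m (fun k => u k x) 1 m) a b.
Proof.
  intros Hu. induction m as [|m IH].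
  - apply ex_RInt_ext with (fun _ => 0); [|apply ex_RInt_const].
    intros x _. rewrite sum_0. reflexivity.
  - apply ex_RInt_ext with (fun x => plus (sum_n_m (fun k => u k x) 1 m) (u (S m) x)).
    + intros x _. rewrite sum_S. reflexivity.
    + apply (ex_RInt_plus (V := R_NormedModule)); auto.
Qed.

(* Rounding the values of [phi] to multiples of [d] gives a combination of indicators of
   initial intervals which is uniformly [d]-close to [phi]. *)
Lemma ex_RInt_nonincreasing (phi : R -> R) (M a b : R) :
  (forall x y, x <= y -> phi y <= phi x) -> (forall x, 0 <= phi x <= M) ->
  a <= b -> ex_RInt phi a b.
Proof.
  intros Hphi HM Hab.
  assert (Happ : forall d, 0 < d -> exists step : R -> R,
             ex_RInt step a b /\ forall x, Rabs (step x - phi x) <= d).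
  { intros d Hd. destruct (exists_small_step M d Hd) as [N [_ HN]].
    exists (fun x => sum_n_m (fun k => d * indicator (fun x => INR k * d <= phi x) x) 1 N).
    split.
    - apply ex_RInt_sum. intros k.
      apply (ex_RInt_scal (V := R_NormedModule)).
      apply ex_RInt_initial_interval; [|exact Hab].
      intros x y Hxy Hy. generalize (Hphi x y Hxy). lra.
    - intros x. specialize (HM x). apply Rabs_le. split.
      (* The term with index [k] lies above the layer of [phi x] from [k d] to [(k + 1) d] and below
         the one from [(k - 1) d] to [k d]. So the layers are based at [d] here and at [0] in the
         upper bound. *)
      + assert (Rmin (Rmax (phi x - d) 0) (INR N * d) <=
                sum_n_m (fun k => d * indicator (fun x => INR k * d <= phi x) x) 1 N).
        { rewrite <- sum_slices by lra. apply sum_le. intros k _.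
          destruct (indicator_cases (fun x => INR k * d <= phi x) x) as [[Hx ->]|[Hx ->]].
          - case_minmax.
          - apply Rnot_le_lt in Hx. replace (d + (INR k - 1) * d) with (INR k * d) by ring.
            case_minmax. }
        revert H. case_minmax.
      + assert (sum_n_m (fun k => d * indicator (fun x => INR k * d <= phi x) x) 1 N
                <= Rmin (Rmax (phi x - 0) 0) (INR N * d)).
        { rewrite <- sum_slices by lra. apply sum_le. intros k _.
          destruct (indicator_cases (fun x => INR k * d <= phi x) x) as [[Hx ->]|[Hx ->]].
          - replace (phi x - (0 + (INR k - 1) * d)) with (phi x - INR k * d + d) by ring.
            case_minmax.
          - case_minmax. }
        revert H. case_minmax. }
  destruct (choice (fun (n : nat) (step : R -> R) =>
      ex_RInt step a b /\ forall x, Rabs (step x - phi x) <= / (INR n + 1)))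
    as [step Hstep].
  { intros n. apply Happ. apply Rinv_0_lt_compat. generalize (pos_INR n). lra. }
  destruct (filterlim_RInt (V := R_CompleteNormedModule) step a b eventually _ phi
              (fun n => RInt (step n) a b)) as [I [_ HI]].
  - intros n. apply (RInt_correct (V := R_CompleteNormedModule)). apply Hstep.
  - apply filterlim_locally. intros eps.
    destruct (archimed_cor1 eps (cond_pos eps)) as [N [HN HN0]].
    exists N. intros n Hn x.
    change (Rabs (step n x - phi x) < eps).
    apply Rle_lt_trans with (1 := proj2 (Hstep n) x).
    apply Rle_lt_trans with (2 := HN). apply Rinv_le_contravar.
    + apply lt_0_INR. exact HN0.
    + apply le_INR in Hn. lra.
  - exists I. exact HI.
Qed.

(* Over a grid of step [d] the increments are bounded by [d] times a telescoping sum. *)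
Lemma constant_of_increments (D phi : R -> R) (M a b : R) :
  a <= b -> (forall x, 0 <= phi x <= M) ->
  (forall x' x y, x' < x -> x < y -> Rabs (D y - D x) <= (y - x) * (phi x' - phi y)) ->
  D b = D a.
Proof.
  intros Hab HM HD. destruct Hab as [Hab|<-]; [|reflexivity].
  assert (HM0 : 0 <= M) by (specialize (HM 0); lra).
  assert (Hgrid : forall N, (0 < N)%nat -> Rabs (D b - D a) <= 2 * M * ((b - a) / INR N)).
  { intros N HN. apply lt_0_INR in HN. set (d := (b - a) / INR N).
    assert (Hd : 0 < d) by (apply Rdiv_lt_0_compat; lra).
    (* Each step takes [x'] one grid point to the left of [x], starting from [a - d]. Differences of
       [phi] over two grid steps telescope to four boundary terms. *)
    assert (Hk : forall k : nat, Rabs (D (a + INR k * d) - D a) <=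
       d * (phi (a - d) + phi a - phi (a + (INR k - 1) * d) - phi (a + INR k * d))).
    { induction k as [|k IH].
      - simpl. replace (a + (0 - 1) * d) with (a - d) by ring.
        replace (a + 0 * d) with a by ring.
        replace (D a - D a) with 0 by ring. rewrite Rabs_R0. lra.
      - rewrite S_INR. replace (INR k + 1 - 1) with (INR k) by ring.
        assert (Hs := HD (a + (INR k - 1) * d) (a + INR k * d) (a + (INR k + 1) * d)).
        replace (a + (INR k + 1) * d - (a + INR k * d)) with d in Hs by ring.
        assert (H1 := Rabs_triang (D (a + (INR k + 1) * d) - D (a + INR k * d))
                        (D (a + INR k * d) - D a)).
        replace (D (a + (INR k + 1) * d) - D (a + INR k * d) + (D (a + INR k * d) - D a))
          with (D (a + (INR k + 1) * d) - D a) in H1 by ring.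
        assert (Rabs (D (a + (INR k + 1) * d) - D (a + INR k * d)) <=
                d * (phi (a + (INR k - 1) * d) - phi (a + (INR k + 1) * d)))
          by (apply Hs; nra).
        lra. }
    specialize (Hk N). replace (a + INR N * d) with b in Hk by (unfold d; field; lra).
    apply Rle_trans with (1 := Hk).
    rewrite (Rmult_comm (2 * M)). apply Rmult_le_compat_l; [lra|].
    assert (H1 := HM (a - d)). assert (H2 := HM a).
    assert (H3 := HM (a + (INR N - 1) * d)). assert (H4 := HM b). lra. }
  assert (Rabs (D b - D a) <= 0).
  { apply le_of_le_plus_eps with (2 * M); [lra|]. intros eps Heps.
    destruct (exists_small_step (b - a) eps Heps) as [N [HN Hlt]].
    apply Rle_trans with (1 := Hgrid N HN). rewrite Rplus_0_l.
    apply Rmult_le_compat_l; [lra|]. apply lt_0_INR in HN.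
    apply Rle_div_l; lra. }
  apply Rminus_diag_uniq. revert H. unfold Rabs. destruct Rcase_abs; lra.
Qed.

(** The integral of [phi] obeys the same two-sided bounds as [G], so their difference has increments
    of the size that [constant_of_increments] admits. *)
Lemma RInt_of_increments (phi G : R -> R) (M a b : R) :
  a <= b -> (forall x y, x <= y -> phi y <= phi x) -> (forall x, 0 <= phi x <= M) ->
  (forall x' x y, x' < x -> x < y ->
     (y - x) * phi y <= G y - G x <= (y - x) * phi x') ->
  RInt phi a b = G b - G a.
Proof.
  intros Hab Hphi HM HG.
  assert (Hex : forall x y, x <= y -> ex_RInt phi x y)
    by (intros x y Hxy; exact (ex_RInt_nonincreasing phi M x y Hphi HM Hxy)).
  assert (Hex' : forall x y, ex_RInt phi x y).
  { intros x y. destruct (Rle_lt_dec x y); [auto|].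
    apply ex_RInt_swap, Hex. lra. }
  assert (Hc : (fun x => G x - RInt phi a x) b = (fun x => G x - RInt phi a x) a).
  { apply (constant_of_increments (fun x => G x - RInt phi a x) phi M); [exact Hab|exact HM|].
    intros x' x y Hx Hy. cbv beta.
    assert (HC : RInt phi a x + RInt phi x y = RInt phi a y).
    { apply (RInt_Chasles (V := R_CompleteNormedModule)); apply Hex'. }
    assert (Hlo : RInt (fun _ => phi y) x y <= RInt phi x y).
    { apply RInt_le; [lra|apply ex_RInt_const|apply Hex; lra|].
      intros z Hz. apply Hphi. lra. }
    assert (Hhi : RInt phi x y <= RInt (fun _ => phi x') x y).
    { apply RInt_le; [lra|apply Hex; lra|apply ex_RInt_const|].
      intros z Hz. apply Hphi. lra. }
    rewrite (RInt_const (V := R_CompleteNormedModule)) in Hlo, Hhi.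
    change (scal (y - x) (phi y)) with ((y - x) * phi y) in Hlo.
    change (scal (y - x) (phi x')) with ((y - x) * phi x') in Hhi.
    assert (H := HG x' x y Hx Hy). apply Rabs_le. lra. }
  cbv beta in Hc. rewrite RInt_point in Hc. change (zero : R_CompleteNormedModule) with 0 in Hc.
  lra.
Qed.

(** * Exact and n-monotone functionals *)

Ltac gamble_ext :=
  apply functional_extensionality; intro;
  unfold gadd, gsub, gscal, gmin, gmax, gconst; try case_minmax.

Lemma gamble_const {Omega : Type} (c : R) : gamble (@gconst Omega c).
Proof. exists (Rabs c). intros w. apply Rle_refl. Qed.

Lemma gamble_bounds {Omega : Type} (f : Omega -> R) (a b : R) :
  (forall w, a <= f w <= b) -> gamble f.
Proof.
  intros Hf. exists (Rabs a + Rabs b). intros w. specialize (Hf w).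
  unfold Rabs. repeat destruct Rcase_abs; lra.
Qed.

Lemma bounds_of_gamble {Omega : Type} (f : Omega -> R) :
  gamble f -> exists M, 0 <= M /\ forall w, - M <= f w <= M.
Proof.
  intros [M HM]. exists (Rabs M). split; [apply Rabs_pos|].
  intros w. specialize (HM w). revert HM. unfold Rabs. repeat destruct Rcase_abs; lra.
Qed.

Lemma gamble_indicator {Omega : Type} (A : Omega -> Prop) : gamble (indicator A).
Proof.
  apply gamble_bounds with 0 1. intros w.
  destruct (indicator_cases A w) as [[_ ->]|[_ ->]]; lra.
Qed.

Lemma gamble_add {Omega : Type} (f g : Omega -> R) :
  gamble f -> gamble g -> gamble (gadd f g).
Proof.
  intros Hf Hg. destruct (bounds_of_gamble f Hf) as [M [_ HM]].
  destruct (bounds_of_gamble g Hg) as [N [_ HN]].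
  apply gamble_bounds with (- M - N) (M + N). intros w.
  specialize (HM w). specialize (HN w). unfold gadd. lra.
Qed.

Lemma gamble_scal {Omega : Type} (a : R) (f : Omega -> R) :
  gamble f -> gamble (gscal a f).
Proof.
  intros [M HM]. exists (Rabs a * M). intros w. unfold gscal. rewrite Rabs_mult.
  apply Rmult_le_compat_l; [apply Rabs_pos|apply HM].
Qed.

Lemma gamble_min {Omega : Type} (f g : Omega -> R) :
  gamble f -> gamble g -> gamble (gmin f g).
Proof.
  intros Hf Hg. destruct (bounds_of_gamble f Hf) as [M [HM0 HM]].
  destruct (bounds_of_gamble g Hg) as [N [HN0 HN]].
  apply gamble_bounds with (- M - N) (M + N). intros w.
  specialize (HM w). specialize (HN w). unfold gmin. case_minmax.
Qed.

Lemma gamble_max {Omega : Type} (f g : Omega -> R) :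
  gamble f -> gamble g -> gamble (gmax f g).
Proof.
  intros Hf Hg. destruct (bounds_of_gamble f Hf) as [M [HM0 HM]].
  destruct (bounds_of_gamble g Hg) as [N [HN0 HN]].
  apply gamble_bounds with (- M - N) (M + N). intros w.
  specialize (HM w). specialize (HN w). unfold gmax. case_minmax.
Qed.

Lemma lincomb_S {Omega : Type} (m : nat) (lams : nat -> R) (fs : nat -> Omega -> R) :
  lincomb (S m) lams fs = gadd (lincomb m lams fs) (gscal (lams (S m)) (fs (S m))).
Proof. apply functional_extensionality. intros w. apply sum_S. Qed.

Lemma lincomb_0 {Omega : Type} (lams : nat -> R) (fs : nat -> Omega -> R) :
  lincomb 0 lams fs = gconst 0.
Proof. apply functional_extensionality. intros w. apply sum_0. Qed.

Lemma gamble_lincomb {Omega : Type} (m : nat) (lams : nat -> R) (fs : nat -> Omega -> R) :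
  (forall k, (1 <= k <= m)%nat -> gamble (fs k)) -> gamble (lincomb m lams fs).
Proof.
  induction m as [|m IH]; intros Hfs.
  - rewrite lincomb_0. apply gamble_const.
  - rewrite lincomb_S. apply gamble_add.
    + apply IH. intros k Hk. apply Hfs. lia.
    + apply gamble_scal, Hfs. lia.
Qed.

Lemma indicator_True {Omega : Type} : @indicator Omega (fun _ => True) = gconst 1.
Proof.
  apply functional_extensionality. intros w. unfold gconst.
  destruct (indicator_cases (fun _ : Omega => True) w) as [[_ ->]|[[] _]]; auto.
Qed.

Lemma indicator_False {Omega : Type} : @indicator Omega (fun _ => False) = gconst 0.
Proof.
  apply functional_extensionality. intros w. unfold gconst.
  destruct (indicator_cases (fun _ : Omega => False) w) as [[[] _]|[_ ->]]; auto.
Qed.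

Lemma indicator_subset {Omega : Type} (A B : Omega -> Prop) :
  (forall w, A w -> B w) -> gle (indicator A) (indicator B).
Proof.
  intros HAB w.
  destruct (indicator_cases A w) as [[HA ->]|[HA ->]];
    destruct (indicator_cases B w) as [[HB ->]|[HB ->]]; try lra.
  destruct (HB (HAB w HA)).
Qed.

(** * Exact functionals, their norm and natural extension *)

Section ExactFunctional.
Context {Omega : Type} {H : (Omega -> R) -> R} (EH : exact_on_all H).

Lemma exact_zero : H (gconst 0) = 0.
Proof.
  replace (@gconst Omega 0) with (gscal 0 (@gconst Omega 0)) by gamble_ext.
  rewrite (exact_scal EH); [ring|apply gamble_const|lra].
Qed.

(** Homogeneity covers [0 <= c]; for negative [c], constant additivity is applied to
    [- c + c = 0]. *)
Lemma exact_gconst (c : R) : H (gconst c) = c * H (gconst 1).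
Proof.
  assert (Hpos : forall c, 0 <= c -> H (gconst c) = c * H (gconst 1)).
  { intros d Hd. rewrite <- (exact_scal EH) by (apply gamble_const || exact Hd).
    f_equal. gamble_ext. }
  destruct (Rle_lt_dec 0 c) as [Hc|Hc]; [auto|].
  assert (Hsum := exact_const EH c (gamble_const (- c))).
  replace (gadd (gconst (- c)) (gconst c)) with (@gconst Omega 0) in Hsum
    by gamble_ext.
  rewrite exact_zero, Hpos in Hsum by lra. lra.
Qed.

Lemma exact_one_nonneg : 0 <= H (gconst 1).
Proof.
  rewrite <- exact_zero. apply (exact_mono EH); try apply gamble_const.
  intros w. unfold gconst. lra.
Qed.

Lemma exact_add_const (f : Omega -> R) (c : R) :
  gamble f -> H (gadd f (gconst c)) = H f + c * H (gconst 1).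
Proof. intros Hf. rewrite (exact_const EH), exact_gconst; auto. Qed.

Lemma exact_lipschitz (f g : Omega -> R) (e : R) :
  gamble f -> gamble g -> (forall w, Rabs (f w - g w) <= e) ->
  Rabs (H f - H g) <= e * H (gconst 1).
Proof.
  intros Hf Hg Hfg.
  assert (Hle : forall u v : Omega -> R, gamble u -> gamble v ->
             (forall w, Rabs (u w - v w) <= e) -> H u <= H v + e * H (gconst 1)).
  { intros u v Hu Hv Huv. rewrite <- exact_add_const by exact Hv.
    apply (exact_mono EH); [|exact Hu|].
    - apply gamble_add; [exact Hv|apply gamble_const].
    - intros w. specialize (Huv w). apply Rabs_le_between in Huv.
      unfold gadd, gconst. lra. }
  assert (H1 := Hle f g Hf Hg Hfg).
  assert (H2 : H g <= H f + e * H (gconst 1)).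
  { apply Hle; auto. intros w. rewrite Rabs_minus_sym. apply Hfg. }
  apply Rabs_le. lra.
Qed.

Lemma exact_lincomb (m : nat) (lams : nat -> R) (fs : nat -> Omega -> R) :
  (forall k, (1 <= k <= m)%nat -> 0 <= lams k /\ gamble (fs k)) ->
  sum_n_m (fun k => lams k * H (fs k)) 1 m <= H (lincomb m lams fs).
Proof.
  induction m as [|m IH]; intros Hfs.
  - rewrite sum_0, lincomb_0, exact_zero. lra.
  - rewrite sum_S, lincomb_S.
    destruct (Hfs (S m)) as [Hlam Hf]; [lia|].
    rewrite <- (exact_scal EH) by assumption.
    eapply Rle_trans; [|apply (exact_superadd EH)].
    + apply Rplus_le_compat_r, IH. intros k Hk. apply Hfs. lia.
    + apply gamble_lincomb. intros k Hk. apply Hfs. lia.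
    + apply gamble_scal, Hf.
Qed.

Context {D : (Omega -> R) -> Prop} {G : (Omega -> R) -> R}.
Context (D_gamble : forall f, D f -> gamble f)
  (G_eq : extends D G H).

(** This one inequality shows both that [H (gconst 1)] is an admissible bound in the norm and that
    [H] dominates the natural extension. *)
Lemma exact_candidate (m : nat) (lams : nat -> R) (lam : R) (f : Omega -> R)
    (fs : nat -> Omega -> R) :
  gamble f -> (forall k, (1 <= k <= m)%nat -> 0 <= lams k /\ D (fs k)) ->
  gle (gadd (lincomb m lams fs) (gconst lam)) f ->
  sum_n_m (fun k => lams k * G (fs k)) 1 m + lam * H (gconst 1) <= H f.
Proof.
  intros Hf Hfs Hle.
  assert (Hgl : gamble (lincomb m lams fs)).
  { apply gamble_lincomb. intros k Hk. apply D_gamble, Hfs, Hk. }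
  apply Rle_trans with (H (gadd (lincomb m lams fs) (gconst lam))).
  - rewrite exact_add_const by exact Hgl. apply Rplus_le_compat_r.
    apply Rle_trans with (sum_n_m (fun k => lams k * H (fs k)) 1 m).
    + apply sum_le. intros k Hk. rewrite G_eq by (apply Hfs, Hk). lra.
    + apply exact_lincomb. intros k Hk. split; [|apply D_gamble]; apply Hfs, Hk.
  - apply (exact_mono EH); [exact Hf| |exact Hle].
    apply gamble_add; [exact Hgl|apply gamble_const].
Qed.

Lemma fnorm_exact : D (gconst 0) -> D (gconst 1) -> fnorm D G = Finite (H (gconst 1)).
Proof.
  intros D0 D1. apply Glb_Rbar_attained.
  - split; [apply exact_one_nonneg|].
    intros m lams lam f fs _ Hfs Hf Hle. rewrite <- (G_eq f Hf).
    apply exact_candidate; auto.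
  - intros c [_ Hc].
    (* Testing [c] on the relation [1 - 1 <= 0] yields [H (gconst 1) <= c]. *)
    specialize (Hc 1%nat (fun _ => 1) (- 1) (gconst 0) (fun _ => gconst 1) (le_n _)).
    rewrite sum_1, <- !G_eq, exact_zero in Hc by assumption.
    assert (1 * H (gconst 1) + - 1 * c <= 0); [|lra]. apply Hc; [|assumption|].
    + intros k _. split; [lra|assumption].
    + intros w. unfold gadd, lincomb, gconst. rewrite sum_1. lra.
Qed.

(** The upper bound comes from [exact_candidate], so only candidates that nearly reach [H f] remain
    to be supplied. It serves for the domain [K] and for the indicators of events. *)
Lemma natural_extension_eq (f : Omega -> R) :
  D (gconst 0) -> D (gconst 1) -> gamble f ->
  (forall eps, 0 < eps -> exists m lams lam fs,
     (1 <= m)%nat /\ (forall k, (1 <= k <= m)%nat -> 0 <= lams k /\ D (fs k)) /\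
     gle (gadd (lincomb m lams fs) (gconst lam)) f /\
     H f <= sum_n_m (fun k => lams k * H (fs k)) 1 m + lam * H (gconst 1) + eps) ->
  natural_extension D G f = Finite (H f).
Proof.
  intros D0 D1 Hf Happ. unfold natural_extension. rewrite fnorm_exact by assumption.
  apply Lub_Rbar_approx.
  - intros x (m & lams & lam & fs & _ & Hfs & Hle & ->).
    apply exact_candidate; assumption.
  - intros eps Heps. destruct (Happ eps Heps) as (m & lams & lam & fs & Hm & Hfs & Hle & HH).
    exists (sum_n_m (fun k => lams k * H (fs k)) 1 m + lam * H (gconst 1)).
    split; [|exact HH]. exists m, lams, lam, fs. repeat split; try assumption.
    { apply Hfs; assumption. } { apply Hfs; assumption. }
    simpl. f_equal. apply sum_n_m_ext_loc. intros k Hk.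
    rewrite G_eq by (apply Hfs, Hk). reflexivity.
Qed.
End ExactFunctional.

(** * Uniform closure of a linear lattice *)

Lemma uniform_closureP {Omega : Type} (S : (Omega -> R) -> Prop) (f : Omega -> R) :
  inhabited Omega ->
  uniform_closure S f <->
  gamble f /\
  forall eps, 0 < eps -> exists g, S g /\ forall w, Rabs (f w - g w) <= eps.
Proof.
  intros [w0]. split; intros [Hf Happ]; split; auto; intros eps Heps.
  - destruct (Happ eps Heps) as [g [Sg Hg]]. exists g. split; [exact Sg|]. intros w.
    destruct (Lub_Rbar_correct (fun x => exists w, x = Rabs (gsub f g w))) as [Hub _].
    assert (Hw := Hub _ (ex_intro _ w eq_refl)).
    assert (Hlt := Rbar_le_lt_trans _ _ _ Hw Hg). simpl in Hlt. unfold gsub in Hlt. lra.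
  - destruct (Happ (eps / 2)) as [g [Sg Hg]]; [lra|]. exists g. split; [exact Sg|].
    apply Rbar_le_lt_trans with (Finite (eps / 2)); [|simpl; lra].
    destruct (Lub_Rbar_correct (fun x => exists w, x = Rabs (gsub f g w))) as [_ Hleast].
    apply Hleast. intros x [w ->]. apply Hg.
Qed.

Lemma Rmin_lipschitz (a b c d e : R) :
  Rabs (a - c) <= e -> Rabs (b - d) <= e -> Rabs (Rmin a b - Rmin c d) <= e.
Proof.
  intros Hac Hbd. apply Rabs_le_between in Hac. apply Rabs_le_between in Hbd.
  apply Rabs_le. case_minmax.
Qed.

Lemma Rmax_lipschitz (a b c d e : R) :
  Rabs (a - c) <= e -> Rabs (b - d) <= e -> Rabs (Rmax a b - Rmax c d) <= e.
Proof.
  intros Hac Hbd. apply Rabs_le_between in Hac. apply Rabs_le_between in Hbd.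
  apply Rabs_le. case_minmax.
Qed.

Lemma uniform_closure_incl {Omega : Type} (S : (Omega -> R) -> Prop) (f : Omega -> R) :
  inhabited Omega -> gamble f -> S f -> uniform_closure S f.
Proof.
  intros HO Hf Sf. apply (uniform_closureP S f HO). split; [exact Hf|].
  intros eps Heps. exists f. split; [exact Sf|]. intros w.
  rewrite Rminus_diag, Rabs_R0. lra.
Qed.

Lemma linear_lattice_closure {Omega : Type} (K : (Omega -> R) -> Prop) :
  inhabited Omega -> linear_lattice K -> linear_lattice (uniform_closure K).
Proof.
  intros HO HK. assert (HL := linlat_lattice HK).
  split; [split| | |].
  - intros f [Hf _]. exact Hf.
  - intros f g. rewrite !uniform_closureP by exact HO. intros [Hf Af] [Hg Ag].
    split; [apply gamble_min; assumption|]. intros eps Heps.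
    destruct (Af eps Heps) as [f' [Kf Hf']]. destruct (Ag eps Heps) as [g' [Kg Hg']].
    exists (gmin f' g'). split; [apply (lattice_min HL); assumption|].
    intros w. apply Rmin_lipschitz; auto.
  - intros f g. rewrite !uniform_closureP by exact HO. intros [Hf Af] [Hg Ag].
    split; [apply gamble_max; assumption|]. intros eps Heps.
    destruct (Af eps Heps) as [f' [Kf Hf']]. destruct (Ag eps Heps) as [g' [Kg Hg']].
    exists (gmax f' g'). split; [apply (lattice_max HL); assumption|].
    intros w. apply Rmax_lipschitz; auto.
  - apply uniform_closure_incl; [exact HO|apply gamble_const|apply (linlat_zero HK)].
  - intros f g. rewrite !uniform_closureP by exact HO. intros [Hf Af] [Hg Ag].
    split; [apply gamble_add; assumption|]. intros eps Heps.
    destruct (Af (eps / 2)) as [f' [Kf Hf']]; [lra|].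
    destruct (Ag (eps / 2)) as [g' [Kg Hg']]; [lra|].
    exists (gadd f' g'). split; [apply (linlat_add HK); assumption|].
    intros w. specialize (Hf' w). specialize (Hg' w).
    apply Rabs_le_between in Hf'. apply Rabs_le_between in Hg'.
    apply Rabs_le. unfold gadd. lra.
  - intros a f. rewrite !uniform_closureP by exact HO. intros [Hf Af].
    split; [apply gamble_scal; assumption|]. intros eps Heps.
    assert (Ha := Rabs_pos a).
    assert (Hd : 0 < eps / (Rabs a + 1)) by (apply Rdiv_lt_0_compat; lra).
    destruct (Af _ Hd) as [f' [Kf Hf']].
    exists (gscal a f'). split; [apply (linlat_scal HK); assumption|].
    intros w. unfold gscal. replace (a * f w - a * f' w) with (a * (f w - f' w)) by ring.
    rewrite Rabs_mult. specialize (Hf' w).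
    replace eps with ((Rabs a + 1) * (eps / (Rabs a + 1))) by (field; lra).
    apply Rmult_le_compat; try apply Rabs_pos; lra.
Qed.

(** * Alternating sums and n-monotonicity *)

Lemma in_subsets (l I : list nat) (i : nat) : In I (subsets l) -> In i I -> In i l.
Proof.
  revert I. induction l as [|j l IH]; simpl; intros I HI Hi.
  - destruct HI as [<-|[]]. exact Hi.
  - apply in_app_or in HI as [HI|HI].
    + right. exact (IH I HI Hi).
    + apply in_map_iff in HI as [J [<- HJ]]. destruct Hi as [<-|Hi]; [left; reflexivity|].
      right. exact (IH J HJ Hi).
Qed.

Lemma lattice_fold_min {Omega : Type} (D : (Omega -> R) -> Prop) (f : Omega -> R)
    (fs : nat -> Omega -> R) (I : list nat) :
  lattice_of_gambles D -> D f -> (forall i, In i I -> D (fs i)) ->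
  D (fold_right (fun i g => gmin (fs i) g) f I).
Proof.
  intros HD Hf. induction I as [|i I IH]; simpl; intros Hfs; [exact Hf|].
  apply (lattice_min HD); auto.
Qed.

Lemma fold_min_lipschitz {Omega : Type} (f g : Omega -> R) (fs gs : nat -> Omega -> R)
    (e : R) (I : list nat) :
  (forall w, Rabs (f w - g w) <= e) ->
  (forall i, In i I -> forall w, Rabs (fs i w - gs i w) <= e) ->
  forall w, Rabs (fold_right (fun i g => gmin (fs i) g) f I w
                  - fold_right (fun i g => gmin (gs i) g) g I w) <= e.
Proof.
  intros Hfg. induction I as [|i I IH]; simpl; intros Hfs w; [apply Hfg|].
  apply Rmin_lipschitz; [apply Hfs; left; reflexivity|].
  apply IH. intros j Hj. apply Hfs. right. exact Hj.
Qed.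

Lemma fold_plus_map_le {A : Type} (u v : A -> R) (e : R) (l : list A) :
  (forall x, In x l -> u x <= v x + e) ->
  fold_right Rplus 0 (map u l) <= fold_right Rplus 0 (map v l) + INR (length l) * e.
Proof.
  induction l as [|x l IH]; simpl length; [simpl; lra|]; intros Huv. simpl fold_right.
  rewrite S_INR. assert (Hx := Huv x (or_introl eq_refl)).
  assert (fold_right Rplus 0 (map u l) <= fold_right Rplus 0 (map v l) + INR (length l) * e)
    by (apply IH; intros y Hy; apply Huv; right; exact Hy).
  lra.
Qed.

Lemma sign_mult_le (k : nat) (x y e : R) :
  Rabs (x - y) <= e -> (-1) ^ k * x <= (-1) ^ k * y + e.
Proof.
  intros Hxy. assert (Hk := pow_1_abs k).
  assert ((-1) ^ k * (x - y) <= e); [|lra].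
  apply Rle_trans with (1 := Rle_abs _). rewrite Rabs_mult, Hk. lra.
Qed.

(** Agreement on [D'] suffices, since every meet in the alternating sum stays in the lattice [D'].
    The lemma is used both to change the functional and to shrink the domain. *)
Lemma n_monotone_restrict {Omega : Type} (n : option nat) (D D' : (Omega -> R) -> Prop)
    (G G' : (Omega -> R) -> R) :
  lattice_of_gambles D' -> (forall f, D' f -> D f) -> extends D' G G' ->
  n_monotone n D G -> n_monotone n D' G'.
Proof.
  intros HD' Hsub HG [_ HM]. split; [exact HD'|].
  intros p f fs Hp Hpn Hf Hfs.
  replace (map _ (subsets (seq 1 p))) with
    (map (fun I => (-1) ^ length I * G (fold_right (fun i g => gmin (fs i) g) f I))
       (subsets (seq 1 p))); [apply HM; auto|].
  apply map_ext_in. intros I HI. rewrite HG; [reflexivity|].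
  apply lattice_fold_min; [exact HD'|exact Hf|].
  intros i Hi. apply Hfs. apply (in_subsets _ _ _ HI) in Hi. apply in_seq in Hi. lia.
Qed.

(** Meets are 1-Lipschitz and [H] is Lipschitz, so replacing all gambles by [eps]-close members of
    [K] changes each term by at most [eps * H (gconst 1)]; the number of terms is fixed. *)
Lemma n_monotone_closure {Omega : Type} (n : option nat) (K : (Omega -> R) -> Prop)
    (H : (Omega -> R) -> R) :
  inhabited Omega -> linear_lattice K -> exact_on_all H ->
  n_monotone n K H -> n_monotone n (uniform_closure K) H.
Proof.
  intros HO HK EH [HL HM].
  assert (HC := linlat_lattice (linear_lattice_closure K HO HK)).
  split; [exact HC|]. intros p f fs Hp Hpn Hf Hfs.
  apply le_of_le_plus_eps with (INR (length (subsets (seq 1 p))) * H (gconst 1)).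
  { apply Rmult_le_pos; [apply pos_INR|apply (exact_one_nonneg EH)]. }
  intros eps Heps.
  assert (Happ : forall h, uniform_closure K h ->
             exists g, K g /\ forall w, Rabs (g w - h w) <= eps).
  { intros h Hh. apply (uniform_closureP K h HO) in Hh as [_ Hh].
    destruct (Hh eps Heps) as [g [Kg Hg]]. exists g. split; [exact Kg|].
    intros w. rewrite Rabs_minus_sym. apply Hg. }
  destruct (Happ f Hf) as [g [Kg Hg]].
  destruct (choice (fun i gi => (1 <= i <= p)%nat ->
              K gi /\ forall w, Rabs (gi w - fs i w) <= eps)) as [gs Hgs].
  { intros i. destruct (excluded_middle_informative (1 <= i <= p)%nat) as [Hi|Hi].
    - destruct (Happ (fs i) (Hfs i Hi)) as [gi Hgi]. exists gi. auto.
    (* Outside [1..p] the family takes an arbitrary value, here [g]. *)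
    - exists g. intros Hi'. destruct (Hi Hi'). }
  apply Rle_trans with (1 := HM p g gs Hp Hpn Kg (fun i Hi => proj1 (Hgs i Hi))).
  rewrite Rmult_assoc, (Rmult_comm (H _)). apply fold_plus_map_le.
  intros I HI.
  assert (HIp : forall i, In i I -> (1 <= i <= p)%nat).
  { intros i Hi. apply (in_subsets _ _ _ HI) in Hi. apply in_seq in Hi. lia. }
  apply sign_mult_le. apply (exact_lipschitz EH).
  - apply (lattice_gamble HL), lattice_fold_min; [exact HL|exact Kg|].
    intros i Hi. apply Hgs, HIp, Hi.
  - apply (lattice_gamble HC), lattice_fold_min; [exact HC|exact Hf|].
    intros i Hi. apply Hfs, HIp, Hi.
  - apply fold_min_lipschitz; [exact Hg|]. intros i Hi. apply Hgs, HIp, Hi.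
Qed.

(** This is the case [p = 2] with first argument the join of [u] and [v]: by absorption, the four
    terms are the values at the join, [v], [u] and the meet. *)
Lemma two_monotone {Omega : Type} (n : option nat) (D : (Omega -> R) -> Prop)
    (G : (Omega -> R) -> R) (u v : Omega -> R) :
  le_infty 2 n -> n_monotone n D G -> D u -> D v ->
  G u + G v <= G (gmax u v) + G (gmin u v).
Proof.
  intros Hn [HL HM] Hu Hv.
  specialize (HM 2%nat (gmax u v) (fun i => if Nat.eqb i 1 then u else v)
                ltac:(lia) Hn (lattice_max HL Hu Hv)).
  assert (Hpos := HM (fun i _ => match Nat.eqb i 1 as b
     return D (if b then u else v) with true => Hu | false => Hv end)).
  simpl in Hpos.
  replace (gmin v (gmax u v)) with v in Hpos by gamble_ext.
  replace (gmin u (gmax u v)) with u in Hpos by gamble_ext.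
  lra.
Qed.

(* The part of [f] between the levels [x] and [y]; since [gmin f y] and the constant [x] have
   meet [gmin f x] and join [x + slice f x y], 2-monotonicity turns superadditivity into an
   equality. *)
Definition slice {Omega : Type} (f : Omega -> R) (x y : R) : Omega -> R :=
  fun w => Rmin (Rmax (f w - x) 0) (y - x).

Lemma gamble_slice {Omega : Type} (f : Omega -> R) (x y : R) :
  x <= y -> gamble (slice f x y).
Proof.
  intros Hxy. apply gamble_bounds with 0 (y - x). intros w. unfold slice. case_minmax.
Qed.

Lemma exact_slice {Omega : Type} (n : option nat) (D : (Omega -> R) -> Prop)
    (H : (Omega -> R) -> R) (f : Omega -> R) (x y : R) :
  exact_on_all H -> le_infty 2 n -> n_monotone n D H -> (forall c, D (gconst c)) ->
  D f -> x <= y ->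
  H (gmin f (gconst y)) - H (gmin f (gconst x)) = H (slice f x y).
Proof.
  intros EH Hn HM Dc Df Hxy. assert (HL := proj1 HM).
  assert (Gs := gamble_slice f x y Hxy).
  assert (Hle : H (gmin f (gconst x)) + H (slice f x y) <= H (gmin f (gconst y))).
  { replace (gmin f (gconst y)) with (gadd (gmin f (gconst x)) (slice f x y))
      by (unfold slice; gamble_ext).
    apply (exact_superadd EH); [|exact Gs].
    apply gamble_min; [apply (lattice_gamble HL Df)|apply gamble_const]. }
  assert (H2 := two_monotone n D H (gmin f (gconst y)) (gconst x) Hn HM
                  (lattice_min HL Df (Dc y)) (Dc x)).
  replace (gmax (gmin f (gconst y)) (gconst x)) with (gadd (slice f x y) (gconst x)) in H2
    by (unfold slice; gamble_ext).
  replace (gmin (gmin f (gconst y)) (gconst x)) with (gmin f (gconst x)) in H2 by gamble_ext.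
  rewrite (exact_const EH) in H2 by exact Gs.
  lra.
Qed.

(** * Level sets and the Choquet integral *)

Lemma ginf_le {Omega : Type} (f : Omega -> R) (w : Omega) : gamble f -> ginf f <= f w.
Proof.
  intros Hf. destruct (bounds_of_gamble f Hf) as [M [_ HM]]. unfold ginf.
  destruct (Glb_Rbar_correct (fun x => exists w, x = f w)) as [Hlb Hgreatest].
  destruct (Glb_Rbar _) as [l| |] eqn:HE; simpl.
  - exact (Hlb (f w) (ex_intro _ w eq_refl)).
  - destruct (Hlb (f w) (ex_intro _ w eq_refl)).
  - destruct (Hgreatest (Finite (- M))). intros x [w' ->]. apply HM.
Qed.

Lemma gsup_lub {Omega : Type} (f : Omega -> R) (w : Omega) :
  gamble f -> f w <= gsup f /\ (forall c, (forall w, f w <= c) -> gsup f <= c).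
Proof.
  intros Hf. destruct (bounds_of_gamble f Hf) as [M [_ HM]]. unfold gsup.
  destruct (Lub_Rbar_bounded (fun x => exists w, x = f w) M (f w)) as [Hub Hleast].
  - exists w. reflexivity.
  - intros x [w' ->]. apply HM.
  - split.
    + apply Hub. exists w. reflexivity.
    + intros c Hc. apply Hleast. intros x [w' ->]. apply Hc.
Qed.

(** The working form of membership in [gambles_of_events]. No level set of [f] has to be an event
    itself, only something between any two of them. *)
Definition levels_separated {Omega : Type} (F : (Omega -> Prop) -> Prop) (f : Omega -> R) : Prop :=
  forall s t, s < t ->
  exists B, F B /\ (forall w, t <= f w -> B w) /\ (forall w, B w -> s <= f w).

Lemma level_events {Omega : Type} (F : (Omega -> Prop) -> Prop) (f : Omega -> R) (a d : R) :
  levels_separated F f -> 0 < d ->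
  exists B : nat -> Omega -> Prop, forall k,
    F (B k) /\ (forall w, a + (INR k - 1) * d <= f w -> B k w) /\
    (forall w, B k w -> a + (INR k - 2) * d <= f w).
Proof.
  intros Hsep Hd. apply (choice (fun k B => F B /\
    (forall w, a + (INR k - 1) * d <= f w -> B w) /\
    (forall w, B w -> a + (INR k - 2) * d <= f w))).
  intros k. apply Hsep. lra.
Qed.

(** The term [d * indicator (B k)] lies above the [k]-th layer of [f] over the base [a], and below
    the [k]-th layer over the base [a - 2 d]; the layers are summed by [sum_slices]. *)
Lemma level_sum_bounds {Omega : Type} (f : Omega -> R) (a d : R) (N : nat)
    (B : nat -> Omega -> Prop) (w : Omega) :
  0 < d -> a <= f w <= a + INR N * d ->
  (forall k, a + (INR k - 1) * d <= f w -> B k w) ->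
  (forall k, B k w -> a + (INR k - 2) * d <= f w) ->
  f w <= a + sum_n_m (fun k => d * indicator (B k) w) 1 N <= f w + 2 * d.
Proof.
  intros Hd Hf HB1 HB2. split.
  - assert (Rmin (Rmax (f w - a) 0) (INR N * d) <= sum_n_m (fun k => d * indicator (B k) w) 1 N).
    { rewrite <- sum_slices by lra. apply sum_le. intros k _.
      destruct (indicator_cases (B k) w) as [[HB ->]|[HB ->]]; [case_minmax|].
      destruct (Rle_lt_dec (a + (INR k - 1) * d) (f w)) as [Hk|Hk]; [destruct (HB (HB1 k Hk))|].
      case_minmax. }
    revert H. case_minmax.
  - assert (sum_n_m (fun k => d * indicator (B k) w) 1 N
            <= Rmin (Rmax (f w - (a - 2 * d)) 0) (INR N * d)).
    { rewrite <- sum_slices by lra. apply sum_le. intros k _.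
      destruct (indicator_cases (B k) w) as [[HB ->]|[HB ->]]; [|case_minmax].
      apply HB2 in HB. case_minmax. }
    revert H. case_minmax.
Qed.

Lemma levels_separated_closure {Omega : Type} (F : (Omega -> Prop) -> Prop) (f : Omega -> R) :
  inhabited Omega -> F (fun _ => True) -> gamble f -> levels_separated F f ->
  gambles_of_events F f.
Proof.
  intros HO FT Hf Hsep. apply (uniform_closureP _ _ HO). split; [exact Hf|].
  intros eps Heps. destruct (bounds_of_gamble f Hf) as [M [_ HM]].
  assert (Hd : 0 < eps / 2) by lra.
  destruct (exists_small_step (2 * M) (eps / 2) Hd) as [N [_ HN]].
  destruct (level_events F f (- M) (eps / 2) Hsep Hd) as [B HB].
  (* The additional index [S N] carries the base level [- M] as a multiple of the indicator of the
     whole space. The step [eps / 2] turns the error [2 d] into [eps]. *)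
  set (lams := fun k => if Nat.eqb k (S N) then - M else eps / 2).
  set (fs := fun k => if Nat.eqb k (S N) then @indicator Omega (fun _ => True)
                      else indicator (B k)).
  exists (lincomb (S N) lams fs). split.
  - exists (S N), lams, fs. split; [|reflexivity].
    intros k _. unfold fs. destruct (Nat.eqb k (S N)).
    + exists (fun _ => True). auto.
    + exists (B k). split; [apply HB|reflexivity].
  - intros w. rewrite lincomb_S. unfold gadd, gscal.
    replace (lams (S N)) with (- M) by (unfold lams; rewrite Nat.eqb_refl; reflexivity).
    replace (fs (S N)) with (@gconst Omega 1)
      by (unfold fs; rewrite Nat.eqb_refl, indicator_True; reflexivity).
    replace (lincomb N lams fs w) with (sum_n_m (fun k => eps / 2 * indicator (B k) w) 1 N).
    + specialize (HM w).
      assert (Hb := level_sum_bounds f (- M) (eps / 2) N B w Hd ltac:(lra)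
                (fun k => proj1 (proj2 (HB k)) w) (fun k => proj2 (proj2 (HB k)) w)).
      unfold gconst. apply Rabs_le. lra.
    + apply sum_n_m_ext_loc. intros k Hk. unfold lams, fs.
      replace (Nat.eqb k (S N)) with false by (symmetry; apply Nat.eqb_neq; lia).
      reflexivity.
Qed.

(** Each further indicator at most doubles the list of values. Finiteness provides the gap below a
    level used in [upper_level_span]. *)
Lemma lincomb_finite_range {Omega : Type} (F : (Omega -> Prop) -> Prop) (m : nat)
    (lams : nat -> R) (fs : nat -> Omega -> R) :
  (forall k, (1 <= k <= m)%nat -> indicators_of F (fs k)) ->
  exists l, forall w, In (lincomb m lams fs w) l.
Proof.
  induction m as [|m IH]; intros Hfs.
  - exists (0 :: nil). intros w. rewrite lincomb_0. left. reflexivity.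
  - destruct IH as [l Hl]; [intros k Hk; apply Hfs; lia|].
    destruct (Hfs (S m)) as [A [_ HA]]; [lia|].
    exists (l ++ map (fun v => v + lams (S m)) l). intros w.
    rewrite lincomb_S. unfold gadd, gscal. rewrite HA. apply in_or_app.
    destruct (indicator_cases A w) as [[_ ->]|[_ ->]].
    + right. rewrite Rmult_1_r. apply (in_map (fun v => v + lams (S m))). apply Hl.
    + left. rewrite Rmult_0_r, Rplus_0_r. apply Hl.
Qed.

Lemma finite_gap_below (l : list R) (t : R) :
  exists eta, 0 < eta /\ forall v, In v l -> v < t -> v <= t - eta.
Proof.
  induction l as [|v l [eta [Heta Hl]]].
  - exists 1. split; [lra|]. intros v [].
  - destruct (Rlt_le_dec v t) as [Hv|Hv].
    + exists (Rmin eta (t - v)). split; [case_minmax|].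
      intros u [<-|Hu] Hut; [case_minmax|]. specialize (Hl u Hu Hut). case_minmax.
    + exists eta. split; [exact Heta|]. intros u [<-|Hu] Hut; [lra|]. auto.
Qed.

(** * The field of events of a linear lattice *)

Section Events.
Context {Omega : Type} {K : (Omega -> R) -> Prop} (HK : linear_lattice K)
  (Hconst : forall mu, K (gconst mu)).

Lemma events_True : events_in K (fun _ => True).
Proof. unfold events_in. rewrite indicator_True. apply Hconst. Qed.

Lemma events_False : events_in K (fun _ => False).
Proof. unfold events_in. rewrite indicator_False. apply Hconst. Qed.

Lemma events_and (A B : Omega -> Prop) :
  events_in K A -> events_in K B -> events_in K (fun w => A w /\ B w).
Proof.
  unfold events_in. intros HA HB.
  replace (indicator (fun w => A w /\ B w)) with (gmin (indicator A) (indicator B)).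
  - apply (lattice_min (linlat_lattice HK)); assumption.
  - apply functional_extensionality. intros w. unfold gmin, indicator.
    repeat destruct excluded_middle_informative; try tauto; case_minmax.
Qed.

Lemma events_or (A B : Omega -> Prop) :
  events_in K A -> events_in K B -> events_in K (fun w => A w \/ B w).
Proof.
  unfold events_in. intros HA HB.
  replace (indicator (fun w => A w \/ B w)) with (gmax (indicator A) (indicator B)).
  - apply (lattice_max (linlat_lattice HK)); assumption.
  - apply functional_extensionality. intros w. unfold gmax, indicator.
    repeat destruct excluded_middle_informative; try tauto; case_minmax.
Qed.

Lemma span_events_incl (g : Omega -> R) : span (indicators_of (events_in K)) g -> K g.
Proof.
  intros (m & lams & fs & Hfs & ->). induction m as [|m IH].
  - rewrite lincomb_0. apply Hconst.
  - rewrite lincomb_S. apply (linlat_add HK).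
    + apply IH. intros k Hk. apply Hfs. lia.
    + apply (linlat_scal HK). destruct (Hfs (S m)) as [A [HA ->]]; [lia|exact HA].
Qed.

Lemma gambles_of_events_incl (f : Omega -> R) :
  gambles_of_events (events_in K) f -> uniform_closure K f.
Proof.
  intros [Hf Happ]. split; [exact Hf|]. intros eps Heps.
  destruct (Happ eps Heps) as [g [Hg Hfg]]. exists g.
  split; [exact (span_events_incl g Hg)|exact Hfg].
Qed.

(* A function with finitely many values has a gap [eta] below the level [t], so its upper level
   set is cut out by lattice operations. *)
Lemma upper_level_span (g : Omega -> R) (t : R) :
  span (indicators_of (events_in K)) g -> events_in K (upper_level g t).
Proof.
  intros Hg. assert (Kg := span_events_incl g Hg).
  destruct Hg as (m & lams & fs & Hfs & Hgl).
  destruct (lincomb_finite_range (events_in K) m lams fs Hfs) as [l Hl].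
  destruct (finite_gap_below l t) as [eta [Heta Hgap]].
  unfold events_in.
  (* The ramp rises from 0 at [t - eta] to 1 at [t]; as [g] has no value strictly in between, it is
     an indicator. *)
  replace (indicator (upper_level g t)) with
    (gmin (gconst 1) (gmax (gconst 0) (gscal (/ eta) (gadd g (gconst (eta - t)))))).
  - apply (lattice_min (linlat_lattice HK)); [apply Hconst|].
    apply (lattice_max (linlat_lattice HK)); [apply Hconst|].
    apply (linlat_scal HK), (linlat_add HK); [exact Kg|apply Hconst].
  - apply functional_extensionality. intros w.
    assert (Hinv : / eta * eta = 1) by (field; lra).
    assert (Hpos : 0 < / eta) by (apply Rinv_0_lt_compat; exact Heta).
    destruct (indicator_cases (upper_level g t) w) as [[Hw ->]|[Hw ->]];
      unfold upper_level in Hw; unfold gmin, gmax, gscal, gadd, gconst.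
    + assert (1 <= / eta * (g w + (eta - t))) by nra. case_minmax.
    + apply Rnot_le_lt in Hw. assert (g w <= t - eta).
      { apply Hgap; [|exact Hw]. rewrite Hgl. apply Hl. }
      assert (/ eta * (g w + (eta - t)) <= 0) by nra. case_minmax.
Qed.

Lemma gambles_of_events_separated (f : Omega -> R) :
  inhabited Omega -> gambles_of_events (events_in K) f -> levels_separated (events_in K) f.
Proof.
  intros HO Hf s t Hst. apply (uniform_closureP _ _ HO) in Hf as [_ Happ].
  (* With this error, the set where [g] reaches the midpoint contains [{f >= t}] and lies in
     [{f >= s}]. *)
  destruct (Happ ((t - s) / 2)) as [g [Hg Hfg]]; [lra|].
  exists (upper_level g ((s + t) / 2)). split; [exact (upper_level_span g _ Hg)|].
  unfold upper_level.
  split; intros w Hw; specialize (Hfg w); apply Rabs_le_between in Hfg; lra.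
Qed.

Lemma gambles_of_events_iff (f : Omega -> R) :
  inhabited Omega ->
  gambles_of_events (events_in K) f <-> gamble f /\ levels_separated (events_in K) f.
Proof.
  intros HO. split.
  - intros Hf. split; [apply Hf|apply gambles_of_events_separated; assumption].
  - intros [Hf Hsep]. apply levels_separated_closure; try assumption. apply events_True.
Qed.

(** In terms of separated levels, meets of gambles take intersections of the separating events and
    joins take unions. *)
Lemma gambles_of_events_lattice :
  inhabited Omega -> lattice_of_gambles (gambles_of_events (events_in K)).
Proof.
  intros HO. split.
  - intros f [Hf _]. exact Hf.
  - intros f g. rewrite !gambles_of_events_iff by exact HO. intros [Hf Sf] [Hg Sg].
    split; [apply gamble_min; assumption|]. intros s t Hst.
    destruct (Sf s t Hst) as [A [FA [A1 A2]]]. destruct (Sg s t Hst) as [B [FB [B1 B2]]].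
    exists (fun w => A w /\ B w). split; [apply events_and; assumption|].
    unfold gmin. split; intros w Hw.
    + split; [apply A1|apply B1]; revert Hw; case_minmax.
    + apply Rmin_glb; [apply A2|apply B2]; apply Hw.
  - intros f g. rewrite !gambles_of_events_iff by exact HO. intros [Hf Sf] [Hg Sg].
    split; [apply gamble_max; assumption|]. intros s t Hst.
    destruct (Sf s t Hst) as [A [FA [A1 A2]]]. destruct (Sg s t Hst) as [B [FB [B1 B2]]].
    exists (fun w => A w \/ B w). split; [apply events_or; assumption|].
    unfold gmax. split; intros w Hw.
    + destruct (Rle_lt_dec t (f w)) as [Hf'|Hf']; [left; apply A1, Hf'|].
      right. apply B1. revert Hw. case_minmax.
    + destruct Hw as [Hw|Hw]; [apply A2 in Hw|apply B2 in Hw]; revert Hw; case_minmax.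
Qed.
End Events.

(* McShane's extension: comonotonicity makes [f] a nondecreasing 1-Lipschitz function of [f + g]. *)
Lemma comonotone_factor {Omega : Type} (f g : Omega -> R) :
  inhabited Omega -> gamble f -> comonotone f g ->
  exists phi : R -> R,
    (forall x y, x <= y -> phi x <= phi y <= phi x + (y - x)) /\
    (forall w, phi (f w + g w) = f w).
Proof.
  intros [w0] Hf Hco. destruct (bounds_of_gamble f Hf) as [M [HM0 HM]].
  (* For each [w] the expression is nondecreasing and 1-Lipschitz in [z], which passes to the
     supremum [phi z]. *)
  set (E := fun z x => exists w, x = f w - Rmax (f w + g w - z) 0).
  assert (HE : forall z, (forall x, E z x -> x <= real (Lub_Rbar (E z))) /\
                (forall c, (forall x, E z x -> x <= c) -> real (Lub_Rbar (E z)) <= c)).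
  { intros z. apply Lub_Rbar_bounded with M (f w0 - Rmax (f w0 + g w0 - z) 0).
    - exists w0. reflexivity.
    - intros x [w ->]. specialize (HM w). case_minmax. }
  exists (fun z => real (Lub_Rbar (E z))). split.
  - intros x y Hxy. split.
    + apply (proj2 (HE x)). intros v [w ->].
      apply Rle_trans with (f w - Rmax (f w + g w - y) 0); [case_minmax|].
      apply (proj1 (HE y)). exists w. reflexivity.
    + apply (proj2 (HE y)). intros v [w ->].
      assert (Hw : f w - Rmax (f w + g w - x) 0 <= real (Lub_Rbar (E x)))
        by (apply (proj1 (HE x)); exists w; reflexivity).
      revert Hw. generalize (real (Lub_Rbar (E x))). intros r. case_minmax.
  - intros w. apply Rle_antisym.
    + apply (proj2 (HE _)). intros v [w' ->].
      (* If [f w < f w'], then [g w <= g w'], so the penalty at [w'] is at least the excess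
         [f w' - f w]. *)
      assert (H1 := Hco w w'). assert (H2 := Hco w' w).
      destruct (Rlt_le_dec (f w) (f w')) as [Hlt|Hle].
      * specialize (H1 Hlt). case_minmax.
      * case_minmax.
    + apply (proj1 (HE _)). exists w.
      replace (f w + g w - (f w + g w)) with 0 by ring. case_minmax.
Qed.

(** The maps [phi] and [x - phi x] are nondecreasing with sum [x], so one of them increases strictly
    from [s] to [t]. An event separating the levels of the corresponding gamble then separates those
    of the sum; the lower level is a midpoint, so that reaching it excludes [f + g < s]. *)
Lemma comonotone_add_separated {Omega : Type} (F : (Omega -> Prop) -> Prop) (f g : Omega -> R)
    (phi : R -> R) :
  levels_separated F f -> levels_separated F g ->
  (forall x y, x <= y -> phi x <= phi y <= phi x + (y - x)) ->
  (forall w, phi (f w + g w) = f w) ->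
  levels_separated F (gadd f g).
Proof.
  intros Sf Sg Hphi Hf s t Hst. unfold gadd.
  destruct (Rle_lt_dec (phi t) (phi s)) as [Hle|Hlt].
  - destruct (Sg ((s - phi s + (t - phi t)) / 2) (t - phi t)) as [B [FB [B1 B2]]]; [lra|].
    exists B. split; [exact FB|]. split; intros w Hw.
    + apply B1. assert (H1 := Hphi _ _ Hw). rewrite Hf in H1. lra.
    + apply B2 in Hw. apply Rnot_lt_le. intros Hlt.
      assert (H1 := Hphi _ _ (Rlt_le _ _ Hlt)). rewrite Hf in H1. lra.
  - destruct (Sf ((phi s + phi t) / 2) (phi t)) as [B [FB [B1 B2]]]; [lra|].
    exists B. split; [exact FB|]. split; intros w Hw.
    + apply B1. assert (H1 := Hphi _ _ Hw). rewrite Hf in H1. lra.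
    + apply B2 in Hw. apply Rnot_lt_le. intros Hlt'.
      assert (H1 := Hphi _ _ (Rlt_le _ _ Hlt')). rewrite Hf in H1. lra.
Qed.

Lemma inner_set_function_ext {Omega : Type} (F : (Omega -> Prop) -> Prop)
    (psi psi' : (Omega -> Prop) -> R) :
  (forall B, F B -> psi B = psi' B) -> inner_set_function F psi = inner_set_function F psi'.
Proof.
  intros Hpsi. apply functional_extensionality. intros A. unfold inner_set_function.
  f_equal. apply Lub_Rbar_eqset. intros x.
  split; intros [B [FB [HB ->]]]; exists B; repeat split; auto; symmetry; auto.
Qed.

(** * Slice estimates, the Choquet integral and comonotone additivity *)

Section LevelSets.
Context {Omega : Type} (HO : inhabited Omega) {n : option nat} (Hn : le_infty 2 n)
  {D : (Omega -> R) -> Prop} {H : (Omega -> R) -> R} (EH : exact_on_all H)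
  (HM : n_monotone n D H) (Dc : forall c, D (gconst c))
  {F : (Omega -> Prop) -> Prop} (FF : F (fun _ => False)) (FT : F (fun _ => True)).

Let psi (A : Omega -> Prop) : R := H (indicator A).
Let inner := inner_set_function F psi.

Lemma psi_bounds (A : Omega -> Prop) : 0 <= psi A <= H (gconst 1).
Proof.
  unfold psi. rewrite <- (exact_zero EH), <- indicator_False, <- indicator_True.
  split; apply (exact_mono EH); try apply gamble_indicator; apply indicator_subset; tauto.
Qed.

Lemma inner_lub (A : Omega -> Prop) :
  (forall B, F B -> (forall w, B w -> A w) -> psi B <= inner A) /\
  (forall c, (forall B, F B -> (forall w, B w -> A w) -> psi B <= c) -> inner A <= c).
Proof.
  destruct (Lub_Rbar_bounded (fun x => exists B, F B /\ (forall w, B w -> A w) /\ x = psi B)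
              (H (gconst 1)) (psi (fun _ => False))) as [Hub Hleast].
  - exists (fun _ => False). split; [exact FF|split; [tauto|reflexivity]].
  - intros x [B [_ [_ ->]]]. apply psi_bounds.
  - split.
    + intros B FB HB. apply Hub. exists B. auto.
    + intros c Hc. apply Hleast. intros x [B [FB [HB ->]]]. auto.
Qed.

Lemma inner_bounds (A : Omega -> Prop) : 0 <= inner A <= H (gconst 1).
Proof.
  destruct (inner_lub A) as [Hub Hleast]. split.
  - apply Rle_trans with (psi (fun _ => False)); [apply psi_bounds|].
    apply Hub; [exact FF|tauto].
  - apply Hleast. intros B _ _. apply psi_bounds.
Qed.

Lemma inner_mono (A B : Omega -> Prop) : (forall w, A w -> B w) -> inner A <= inner B.
Proof.
  intros HAB. apply (proj2 (inner_lub A)). intros C FC HC.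
  apply (proj1 (inner_lub B)); auto.
Qed.

Lemma inner_True : inner (fun _ => True) = H (gconst 1).
Proof.
  apply Rle_antisym; [apply inner_bounds|].
  rewrite <- indicator_True. apply (proj1 (inner_lub _)); auto.
Qed.

(** The slice of [u] from [p] to [q] is full on [{h >= y}] and vanishes where [h <= x]. Events
    inside [{h >= y}] bound it from below; an event between [{h >= x}] and [{h >= x'}] bounds it
    from above. Keeping [u] and [h] apart lets two comonotone gambles share the level sets of their
    sum. *)
Lemma increment_bounds (u h : Omega -> R) (p q x' x y : R) :
  D u -> levels_separated F h -> p <= q -> x' < x ->
  (forall w, y <= h w -> q <= u w) -> (forall w, h w <= x -> u w <= p) ->
  (q - p) * inner (upper_level h y) <= H (gmin u (gconst q)) - H (gmin u (gconst p))
    <= (q - p) * inner (upper_level h x').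
Proof.
  intros Du Sh Hpq Hx Hy Hp.
  rewrite (exact_slice n D H u p q EH Hn HM Dc Du Hpq).
  assert (Gs := gamble_slice u p q Hpq). split.
  - assert (Hsub : forall B, F B -> (forall w, B w -> upper_level h y w) ->
              (q - p) * psi B <= H (slice u p q)).
    { intros B _ HB. unfold psi. rewrite <- (exact_scal EH) by (apply gamble_indicator || lra).
      apply (exact_mono EH); [exact Gs|apply gamble_scal, gamble_indicator|].
      intros w. unfold gscal, slice.
      destruct (indicator_cases B w) as [[Bw ->]|[_ ->]]; [|case_minmax].
      specialize (Hy w (HB w Bw)). case_minmax. }
    (* For [p < q], division by [q - p] allows passing to the supremum over events. For [p = q],
       both sides of the product bound reduce to nonnegativity, given by the empty event. *)
    destruct Hpq as [Hpq|<-].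
    + rewrite Rmult_comm. apply Rle_div_r; [lra|].
      apply (proj2 (inner_lub _)). intros B FB HB. apply Rle_div_r; [lra|].
      rewrite Rmult_comm. auto.
    + assert (H0 := Hsub (fun _ => False) FF (fun _ => False_ind _)). lra.
  - destruct (Sh x' x Hx) as [B [FB [B1 B2]]].
    apply Rle_trans with ((q - p) * psi B).
    + unfold psi. rewrite <- (exact_scal EH) by (apply gamble_indicator || lra).
      apply (exact_mono EH); [apply gamble_scal, gamble_indicator|exact Gs|].
      intros w. unfold gscal, slice.
      destruct (indicator_cases B w) as [[_ ->]|[Bw ->]]; [case_minmax|].
      assert (u w <= p); [|case_minmax].
      apply Hp. apply Rnot_lt_le. intros Hlt. apply Bw, B1. lra.
    + apply Rmult_le_compat_l; [lra|]. apply (proj1 (inner_lub _)); [exact FB|exact B2].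
Qed.

Lemma gmin_above (f : Omega -> R) (b : R) : (forall w, f w <= b) -> gmin f (gconst b) = f.
Proof. intros Hf. gamble_ext. apply Rmin_left, Hf. Qed.

Lemma gmin_below (f : Omega -> R) (a : R) :
  (forall w, a <= f w) -> gmin f (gconst a) = gconst a.
Proof. intros Hf. gamble_ext. apply Rmin_right, Hf. Qed.

(** The function [x -> H (gmin f (gconst x))] has the increments required by [RInt_of_increments].
    It equals [H f] at [gsup f], and at [ginf f] it equals the first term of the Choquet
    integral. *)
Lemma choquet_eq (f : Omega -> R) :
  D f -> levels_separated F f ->
  ex_RInt (fun x => inner (upper_level f x)) (ginf f) (gsup f) /\ choquet inner f = H f.
Proof.
  intros Df Sf. assert (Gf := lattice_gamble (proj1 HM) Df).
  assert (Hinf : forall w, ginf f <= f w) by (intros w; apply ginf_le, Gf).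
  assert (Hsup : forall w, f w <= gsup f) by (intros w; apply (gsup_lub f w Gf)).
  assert (Hab : ginf f <= gsup f)
    by (destruct HO as [w]; apply Rle_trans with (f w); auto).
  assert (Hmono : forall x y, x <= y ->
            inner (upper_level f y) <= inner (upper_level f x)).
  { intros x y Hxy. apply inner_mono. unfold upper_level. intros w. lra. }
  split.
  - apply ex_RInt_nonincreasing with (H (gconst 1)); auto.
    intros x. apply inner_bounds.
  - unfold choquet. rewrite inner_True.
    rewrite (RInt_of_increments _ (fun x => H (gmin f (gconst x))) (H (gconst 1)));
      [|exact Hab|exact Hmono|intros x; apply inner_bounds|].
    + rewrite gmin_above, gmin_below, (exact_gconst EH (ginf f)) by assumption. ring.
    + intros x' x y Hx Hy. apply increment_bounds with x; auto; lra.
Qed.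

Lemma comonotone_additive_levels (f g : Omega -> R) :
  D f -> D g -> D (gadd f g) -> levels_separated F f -> levels_separated F g ->
  comonotone f g -> H (gadd f g) = H f + H g.
Proof.
  intros Df Dg Dh Sf Sg Hco.
  assert (Gf := lattice_gamble (proj1 HM) Df).
  assert (Gh := lattice_gamble (proj1 HM) Dh).
  destruct (comonotone_factor f g HO Gf Hco) as [phi [Hphi Hf]].
  assert (Sh := comonotone_add_separated F f g phi Sf Sg Hphi Hf).
  set (h := gadd f g) in *.
  destruct (bounds_of_gamble h Gh) as [M [HM0 HMb]].
  assert (Hfh : forall w, phi (h w) = f w) by exact Hf.
  assert (Hgh : forall w, h w - phi (h w) = g w)
    by (intros w; rewrite Hfh; unfold h, gadd; ring).
  (* The additivity defect of [f], [g] and [h], cut at matching levels, is constant. The widths of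
     the slices of [f] and [g] add up to [y - x], so the sum of their increments obeys the same
     bounds as the increment of [h]. *)
  assert (Hc : (fun x => H (gmin f (gconst (phi x))) + H (gmin g (gconst (x - phi x)))
                  - H (gmin h (gconst x))) M
             = (fun x => H (gmin f (gconst (phi x))) + H (gmin g (gconst (x - phi x)))
                  - H (gmin h (gconst x))) (- M)).
  { apply (constant_of_increments
             (fun x => H (gmin f (gconst (phi x))) + H (gmin g (gconst (x - phi x)))
                  - H (gmin h (gconst x)))
             (fun x => inner (upper_level h x)) (H (gconst 1)));
      [lra|intros x; apply inner_bounds|].
    intros x' x y Hx Hy. cbv beta.
    assert (Hxy := Hphi x y (Rlt_le _ _ Hy)).
    assert (Bf := increment_bounds f h (phi x) (phi y) x' x y Df Sh ltac:(lra) Hx).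
    assert (Bg := increment_bounds g h (x - phi x) (y - phi y) x' x y Dg Sh ltac:(lra) Hx).
    assert (Bh := increment_bounds h h x y x' x y Dh Sh ltac:(lra) Hx
                    (fun _ Hw => Hw) (fun _ Hw => Hw)).
    specialize (Bf ltac:(intros w Hw; rewrite <- Hfh; apply Hphi, Hw)
                   ltac:(intros w Hw; rewrite <- Hfh; apply Hphi, Hw)).
    specialize (Bg ltac:(intros w Hw; rewrite <- Hgh; specialize (Hphi _ _ Hw); lra)
                   ltac:(intros w Hw; rewrite <- Hgh; specialize (Hphi _ _ Hw); lra)).
    apply Rabs_le. lra. }
  cbv beta in Hc.
  (* At [M] the cuts leave all three gambles unchanged. At [- M] they leave constants, whose defect
     is zero. *)
  assert (Htop : forall w, f w <= phi M /\ g w <= M - phi M).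
  { intros w. rewrite <- Hgh, <- Hfh. specialize (Hphi (h w) M (proj2 (HMb w))). lra. }
  assert (Hbot : forall w, phi (- M) <= f w /\ - M - phi (- M) <= g w).
  { intros w. rewrite <- Hgh, <- Hfh. specialize (Hphi (- M) (h w) (proj1 (HMb w))). lra. }
  rewrite !gmin_above in Hc by (intros w; apply Htop || apply HMb).
  rewrite !gmin_below in Hc by (intros w; apply Hbot || apply HMb).
  rewrite (exact_gconst EH (phi (- M))), (exact_gconst EH (- M - phi (- M))),
    (exact_gconst EH (- M)) in Hc.
  lra.
Qed.

(** The level sum of events overshoots [f] by at most [2 d]; lowering it by [2 d] makes it a
    candidate, at a cost of [2 d * H (gconst 1)]. *)
Lemma natural_extension_events (G : (Omega -> R) -> R) (f : Omega -> R) :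
  extends (indicators_of F) G H -> D f -> levels_separated F f ->
  natural_extension (indicators_of F) G f = Finite (H f).
Proof.
  intros HG Df Sf. assert (Gf := lattice_gamble (proj1 HM) Df).
  apply (natural_extension_eq EH); try assumption.
  - intros g [A [_ ->]]. apply gamble_indicator.
  - exists (fun _ => False). split; [exact FF|symmetry; apply indicator_False].
  - exists (fun _ => True). split; [exact FT|symmetry; apply indicator_True].
  - intros eps Heps. destruct (bounds_of_gamble f Gf) as [M [HM0 HMb]].
    assert (H1 := exact_one_nonneg EH).
    set (d := eps / (2 * (H (gconst 1) + 1))).
    assert (Hd : 0 < d) by (apply Rdiv_lt_0_compat; lra).
    assert (Hdeps : 2 * d * (H (gconst 1) + 1) = eps) by (unfold d; field; lra).
    destruct (exists_small_step (2 * M) d Hd) as [N [HN HNd]].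
    destruct (level_events F f (- M) d Sf Hd) as [B HB].
    exists N, (fun _ => d), (- M - 2 * d), (fun k => indicator (B k)). repeat split.
    + lia.
    + lra.
    + exists (B k). split; [apply HB|reflexivity].
    + intros w. specialize (HMb w).
      assert (Hb := level_sum_bounds f (- M) d N B w Hd ltac:(lra)
                (fun k => proj1 (proj2 (HB k)) w) (fun k => proj2 (proj2 (HB k)) w)).
      unfold gadd, lincomb, gconst. lra.
    (* By [exact_slice], [H] is built up slice by slice, and each slice lies below [d] times the
       indicator of its event. Superadditivity alone would give the opposite inequality. *)
    + assert (Hsum : forall k : nat, H (gmin f (gconst (- M + INR k * d))) <=
                sum_n_m (fun k => d * H (indicator (B k))) 1 k + - M * H (gconst 1)).
      { induction k as [|k IH].
        - rewrite sum_0. simpl. rewrite Rmult_0_l, Rplus_0_r.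
          rewrite gmin_below, (exact_gconst EH (- M)) by (intros w; apply HMb). lra.
        - rewrite sum_S, S_INR.
          assert (Hs := exact_slice n D H f (- M + INR k * d) (- M + (INR k + 1) * d)
                          EH Hn HM Dc Df ltac:(lra)).
          assert (H (slice f (- M + INR k * d) (- M + (INR k + 1) * d))
                  <= d * H (indicator (B (S k)))); [|lra].
          rewrite <- (exact_scal EH) by (apply gamble_indicator || lra).
          apply (exact_mono EH);
            [apply gamble_scal, gamble_indicator|apply gamble_slice; lra|].
          intros w. unfold gscal, slice.
          destruct (HB (S k)) as [_ [HB1 _]]. specialize (HB1 w). rewrite S_INR in HB1.
          destruct (indicator_cases (B (S k)) w) as [[_ ->]|[Bw ->]]; [case_minmax|].
          assert (f w < - M + INR k * d); [|case_minmax].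
          apply Rnot_le_lt. intros Hle. apply Bw, HB1. lra. }
      specialize (Hsum N). rewrite gmin_above in Hsum by (intros w; specialize (HMb w); lra).
      lra.
Qed.
End LevelSets.

Lemma natural_extension_closure {Omega : Type} (K : (Omega -> R) -> Prop)
    (G H : (Omega -> R) -> R) (f : Omega -> R) :
  inhabited Omega -> linear_lattice K -> (forall mu, K (gconst mu)) ->
  exact_on_all H -> extends K G H -> uniform_closure K f ->
  natural_extension K G f = Finite (H f).
Proof.
  intros HO HK Hconst EH HG Hf. apply (uniform_closureP K f HO) in Hf as [Gf Happ].
  assert (KG : forall g, K g -> gamble g) by exact (lattice_gamble (linlat_lattice HK)).
  apply (natural_extension_eq EH); auto. intros eps Heps.
  assert (H1 := exact_one_nonneg EH).
  set (d := eps / (2 * (H (gconst 1) + 1))).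
  assert (Hd : 0 < d) by (apply Rdiv_lt_0_compat; lra).
  assert (Hdeps : 2 * d * (H (gconst 1) + 1) = eps) by (unfold d; field; lra).
  destruct (Happ d Hd) as [g [Kg Hg]].
  (* A single [g] in [K], lowered by [d], lies below [f]. The lowering and the approximation each
     cost at most [d * H (gconst 1)]. *)
  exists 1%nat, (fun _ => 1), (- d), (fun _ => g). repeat split; auto; try lra.
  - intros w. specialize (Hg w). apply Rabs_le_between in Hg.
    unfold gadd, lincomb, gconst. rewrite sum_1. lra.
  - assert (Hl := exact_lipschitz EH f g d Gf (KG g Kg) Hg). apply Rabs_le_between in Hl.
    rewrite sum_1. lra.
Qed.

Theorem theorem17 (Omega : Type) (HOmega : inhabited Omega)
    (n : option nat) (Hn : le_infty 2 n)
    (K : (Omega -> R) -> Prop) (HK : linear_lattice K)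
    (Hconst : forall mu : R, K (gconst mu))
    (Gamma : (Omega -> R) -> R)
    (Hexact : exact K Gamma) (Hmono : n_monotone n K Gamma) :
  (exists Gamma' : (Omega -> R) -> R,
     exact (uniform_closure K) Gamma' /\ extends K Gamma Gamma' /\
     n_monotone n (uniform_closure K) Gamma' /\
     (forall Gamma'' : (Omega -> R) -> R,
        exact (uniform_closure K) Gamma'' -> extends K Gamma Gamma'' ->
        forall f, uniform_closure K f -> Gamma'' f = Gamma' f)) /\
  (let F := events_in K in
   let Psi := fun A : Omega -> Prop => Gamma (indicator A) in
   let Psi_inner := inner_set_function F Psi in
   (forall f, gambles_of_events F f ->
      natural_extension K Gamma f = natural_extension (indicators_of F) Gamma f /\
      natural_extension (indicators_of F) Gamma f = Finite (choquet Psi_inner f) /\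
      ex_RInt (fun x => Psi_inner (upper_level f x)) (ginf f) (gsup f) /\
      choquet Psi_inner f =
        real (fnorm K Gamma) * ginf f
        + RInt (fun x => Psi_inner (upper_level f x)) (ginf f) (gsup f)) /\
   n_monotone n (gambles_of_events F) (fun f => real (natural_extension K Gamma f)) /\
   comonotone_additive (gambles_of_events F)
     (fun f => real (natural_extension K Gamma f))).
Proof.
  destruct Hexact as [H [EH HG]].
  assert (HL := linlat_lattice HK).
  assert (KG : forall f, K f -> gamble f) by exact (lattice_gamble HL).
  assert (Kcl : forall f, K f -> uniform_closure K f)
    by (intros f Kf; apply uniform_closure_incl; auto).
  assert (MK : n_monotone n K H) by exact (n_monotone_restrict n K K Gamma H HL (fun f Kf => Kf) HG Hmono).
  assert (MC := n_monotone_closure n K H HOmega HK EH MK).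
  assert (Dc : forall c, uniform_closure K (gconst c)) by auto.
  assert (HC := linear_lattice_closure K HOmega HK).
  assert (Hnat : forall f, uniform_closure K f -> natural_extension K Gamma f = Finite (H f))
    by (intros f; apply natural_extension_closure; assumption).
  assert (Hincl := gambles_of_events_incl HK Hconst).
  split.
  (* The extension of [Gamma] to all gambles supplied by exactness also serves as the extension to
     the closure. *)
  - exists H. split; [|split; [exact HG|split; [exact MC|]]].
    + exists H. split; [exact EH|]. intros f _. reflexivity.
    + intros G' [H' [EH' HG']] HGG' f Cf. rewrite <- (HG' f Cf).
      assert (HH' : forall g, K g -> H' g = H g).
      { intros g Kg. rewrite (HG' g (Kcl g Kg)), (HGG' g Kg). symmetry. exact (HG g Kg). }
      assert (Gf := proj1 Cf). apply (uniform_closureP K f HOmega) in Cf as [_ Happ].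
      assert (H1 := exact_one_nonneg EH).
      assert (Rabs (H' f - H f) <= 0).
      (* Both extensions agree at the constant 1, hence have the same Lipschitz constant. Comparison
         through a common [g] in [K] uses it twice. *)
      { apply le_of_le_plus_eps with (2 * H (gconst 1)); [lra|]. intros eps Heps.
        destruct (Happ eps Heps) as [g [Kg Hg]].
        assert (L1 := exact_lipschitz EH f g eps Gf (KG g Kg) Hg).
        assert (L2 := exact_lipschitz EH' f g eps Gf (KG g Kg) Hg).
        rewrite (HH' g Kg), (HH' _ (Hconst 1)) in L2.
        apply Rabs_le_between in L1. apply Rabs_le_between in L2. apply Rabs_le. lra. }
      apply Rabs_le_between in H0. lra.
  - intros F Psi Psi_inner.
    assert (HGF : extends (indicators_of F) Gamma H).
    { intros f [A [FA ->]]. apply HG, FA. }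
    assert (Hinner : Psi_inner = inner_set_function F (fun A => H (indicator A))).
    { apply inner_set_function_ext. intros B FB. symmetry. apply HG, FB. }
    assert (FF := events_False Hconst). assert (FT := events_True Hconst).
    split; [|split].
    + intros f Lf. assert (Df := Hincl f Lf).
      assert (Sf := gambles_of_events_separated HK Hconst f HOmega Lf).
      assert (HE : natural_extension (indicators_of F) Gamma f = Finite (H f))
        by exact (natural_extension_events Hn EH MC Dc FF FT Gamma f HGF Df Sf).
      rewrite (Hnat f Df), HE, Hinner.
      destruct (choquet_eq HOmega Hn EH MC Dc FF FT f Df Sf) as [Hex Hch].
      repeat split.
      * f_equal. symmetry. exact Hch.
      * exact Hex.
      (* The norm and the inner set function of the whole space are both [H (gconst 1)]. *)
      * rewrite (fnorm_exact EH KG HG) by apply Hconst. unfold choquet.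
        f_equal. f_equal. exact (inner_True EH FF FT).
    + apply (n_monotone_restrict n (uniform_closure K) _ H); [|exact Hincl| |exact MC].
      * apply gambles_of_events_lattice; assumption.
      * intros f Lf. rewrite Hnat by auto. reflexivity.
    + intros f g Lf Lg Hco.
      rewrite !Hnat by (try apply (linlat_add HC); apply Hincl; assumption).
      simpl. apply (comonotone_additive_levels HOmega Hn EH MC Dc FF); auto.
      * apply (linlat_add HC); auto.
      * apply gambles_of_events_separated; assumption.
      * apply gambles_of_events_separated; assumption.
Qed.
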